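(* Let $\Gamma=(X,R)$ be a bipartite distance-regular graph with diameter $D\ge 4$ and valency $k\ge 3$. Let $\Delta=(k-2)(c_3-1)-(c_2-1)p^2_{22}$. Then the following (i)--(iii) are equivalent: (i) $\Gamma$ is taut; (ii) $\Delta\ne0$ and $\Gamma$ is spectrally taut with respect to each vertex; (iii) $\Delta\ne0$ and $\Gamma$ is spectrally taut with respect to at least one vertex.
   Context: Graphs are finite, undirected, connected, without loops or multiple edges; $\partial$ denotes path-length distance. A graph $\Gamma=(X,R)$ of diameter $D$ is distance-regular if for all $0\le h,i,j\le D$ and all $x,y\in X$ with $\partial(x,y)=h$ the number $p^h_{ij}=|\{z\in X:\partial(x,z)=i,\ \partial(z,y)=j\}|$ depends only on $h,i,j$. Write $c_i=p^i_{1,i-1}$, $b_i=p^i_{1,i+1}$, $k=b_0$ (the valency), $k_i=p^0_{ii}$. $\Gamma$ is bipartite if $X$ can be partitioned into two subsets neither of which contains an edge. The distinct eigenvalues of the adjacency matrix are real and indexed $\theta_0>\theta_1>\cdots>\theta_D$; put $d=\lfloor D/2\rfloor$. For bipartite $\Gamma$ with $D\ge4$, $\theta_1^2>b_2>\theta_d^2$. Taut: it is known that $$b_3\bigl(b_2(k-2)-(c_2-1)\theta_1^2\bigr)\bigl(b_2(k-2)-(c_2-1)\theta_d^2\bigr)\ \ge\ b_1\Delta(\theta_1^2-b_2)(b_2-\theta_d^2),$$ with every factor nonnegative. $\Gamma$ is called taut if $\Delta\ne0$ and equality holds in this inequality. Local eigenvalues: for $x\in X$, $\Gamma_2^2(x)$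 is the graph with vertex set $\{y\in X:\partial(x,y)=2\}$ in which $y,z$ are adjacent iff $\partial(y,z)=2$ (distance in $\Gamma$). It has $k_2$ vertices. The eigenvalues (with multiplicity) $\eta_1,\ldots,\eta_{k_2}$ of its adjacency matrix are the local eigenvalues with respect to $x$; it is known that they can be ordered so that $\eta_1=p^2_{22}$ and $\eta_i=b_3-1$ for $2\le i\le k$, and this ordering is assumed. Put $\tilde\theta_1=-1-b_2b_3(\theta_1^2-b_2)^{-1}$ and $\tilde\theta_d=-1-b_2b_3(\theta_d^2-b_2)^{-1}$. $\Gamma$ is spectrally taut with respect to $x$ if $\eta_i\in\{\tilde\theta_1,\tilde\theta_d\}$ for $k+1\le i\le k_2$. *)

(* Defs.v *)
From HB Require Import structures.
From mathcomp Require Import all_boot all_order all_algebra.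
From mathcomp Require Import polyrcf.

Set Implicit Arguments.
Unset Strict Implicit.
Unset Printing Implicit Defensive.

Import Order.TTheory GRing.Theory Num.Theory.
Local Open Scope ring_scope.

Section Graphs.
Variables (X : finType) (e : rel X).

Definition simple_connected_graph : Prop :=
  [/\ symmetric e, irreflexive e & forall x y, connect e x y].

Definition walk (n : nat) (x y : X) : bool :=
  [exists s : n.-tuple X, path e x s && (last x s == y)].

(* Two vertices joined by a walk are joined by one of length < #|X|; the value
   is the junk #|X| when there is none, which connectedness excludes. *)
Definition dist (x y : X) : nat :=
  find (fun n => walk n x y) (iota 0 #|X|).

Definition diameter : nat := (\max_(x : X) \max_(y : X) dist x y)%N.

(* [p h i j] is p^h_{ij}. It is determined by the graph for h, i, j at most the
   diameter, since every such h is a distance; other values are unconstrained. *)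
Definition distance_regular (p : nat -> nat -> nat -> nat) : Prop :=
  forall h i j : nat,
    (h <= diameter)%N -> (i <= diameter)%N -> (j <= diameter)%N ->
    forall x y : X, dist x y = h ->
      #|[set z | (dist x z == i) && (dist z y == j)]| = p h i j.

Definition bipartite : Prop :=
  exists A : {set X},
    (forall x y, x \in A -> y \in A -> ~~ e x y) /\
    (forall x y, x \notin A -> y \notin A -> ~~ e x y).

End Graphs.

Section IntersectionNumbers.
Variable p : nat -> nat -> nat -> nat.

Definition cnum (i : nat) : nat := p i 1%N i.-1.
Definition bnum (i : nat) : nat := p i 1%N i.+1.
Definition valency : nat := bnum 0.
Definition knum (i : nat) : nat := p 0%N i i.

Definition Delta (R : pzRingType) : R :=
  (valency%:R - 2) * ((cnum 3)%:R - 1) - ((cnum 2)%:R - 1) * (p 2 2 2)%:R.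

End IntersectionNumbers.

(* Adjacency matrix of the graph with vertex set S and adjacency relation r. *)
Definition adjmx (R : pzRingType) (X : finType) (S : {set X}) (r : rel X) :
    'M[R]_#|S| :=
  \matrix_(i, j) (r (enum_val i) (enum_val j))%:R.

Section Eigenvalues.
Variables (R : rcfType) (X : finType) (e : rel X).

(* [rootsR] lists the distinct roots in increasing order. *)
Definition eigenvalues : seq R :=
  rev (rootsR (char_poly (adjmx R [set: X] e))).

Lemma mem_eigenvalues (a : R) :
  (a \in eigenvalues) = eigenvalue (adjmx R [set: X] e) a.
Proof.
rewrite mem_rev eigenvalue_root_char.
have := roots_on_rootsR (monic_neq0 (char_poly_monic (adjmx R [set: X] e))).
by move=> /(_ a) <-; rewrite inE.
Qed.

Lemma eigenvalues_decreasing : sorted >%R eigenvalues.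
Proof. by rewrite rev_sorted; exact: sorted_roots. Qed.

Definition theta (i : nat) : R := eigenvalues`_i.

End Eigenvalues.

Section Taut.
Variables (R : rcfType) (X : finType) (e : rel X).
Variable p : nat -> nat -> nat -> nat.

Let d : nat := (diameter e)./2.
Let th1 : R := theta R e 1.
Let thd : R := theta R e d.
Let k : R := (valency p)%:R.
Let b (i : nat) : R := (bnum p i)%:R.
Let c (i : nat) : R := (cnum p i)%:R.

Definition taut : Prop :=
  Delta p R != 0 /\
  b 3 * (b 2 * (k - 2) - (c 2 - 1) * th1 ^+ 2)
      * (b 2 * (k - 2) - (c 2 - 1) * thd ^+ 2)
  = b 1 * Delta p R * (th1 ^+ 2 - b 2) * (b 2 - thd ^+ 2).

Definition theta_tilde (t : R) : R := - 1 - b 2 * b 3 * (t ^+ 2 - b 2)^-1.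

Definition local_adjmx (x : X) : 'M[R]_#|[set y | dist e x y == 2]| :=
  adjmx R [set y | dist e x y == 2] (fun y z => dist e y z == 2).

(* eta 1, ..., eta k_2 are the eigenvalues with multiplicity; other values of
   eta are irrelevant. *)
Definition local_eigenvalues (x : X) (eta : nat -> R) : Prop :=
  [/\ char_poly (local_adjmx x)
        = \prod_(1 <= i < (knum p 2).+1) ('X - (eta i)%:P),
      eta 1%N = (p 2 2 2)%:R
    & forall i : nat, (2 <= i <= valency p)%N -> eta i = b 3 - 1].

(* The ordering fixes the multiset of the eta i with k + 1 <= i <= k_2, so the
   condition does not depend on the choice of eta. *)
Definition spectrally_taut (x : X) : Prop :=
  exists2 eta : nat -> R, local_eigenvalues x eta &
    forall i : nat, ((valency p).+1 <= i <= knum p 2)%N ->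
      eta i = theta_tilde th1 \/ eta i = theta_tilde thd.

End Taut.

(* Main.v *)
Require Import Defs.
From HB Require Import structures.
From mathcomp Require Import all_boot all_order all_algebra.
From mathcomp Require Import complex zify ring lra.

Set Implicit Arguments.
Unset Strict Implicit.
Unset Printing Implicit Defensive.

Import Order.TTheory GRing.Theory Num.Theory.
Local Open Scope ring_scope.

(** The spectrum of the second neighbourhood graph of a vertex [x] and the
    spectrum of the graph control each other through positive
    semidefiniteness.

    Let [B] be the adjacency matrix of the local graph. Besides [p^2_22],
    with the constant eigenvector, and [b_3 - 1], with an eigenspace
    containing the images of the zero-sum vectors on the neighbours of [x],
    it has [k_2 - k] eigenvalues [eta] left, all with eigenvectors [w]
    orthogonal to the constant ones. For an eigenvalue [t] of the graph, the
    entries of the primitive idempotent [E] of [t] depend only on the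
    distance, and the form [w E w^T] is nonnegative. Distances inside the
    second neighbourhood are 0, 2 and 4, so this form only involves [eta]
    and the three coefficients of [E] at these distances, which the
    three-term recurrence gives as polynomials in [t]. The outcome is
      [0 <= b_2 b_3 + (1 + eta) (t^2 - b_2)]
    as soon as [t^2 < k^2] ([local_eigenvalue_bound]). For [t = theta_1],
    where [t^2 > b_2], this bounds [eta] below by its first tilde value, and
    for [t = theta_d], where [t^2 < b_2], above by the other one.

    Hence each product of [eta - tilde_1] and [tilde_d - eta] is
    nonnegative, and [x] is spectrally taut exactly when the sum of these
    products over the remaining [eta] vanishes. That sum is determined by
    the number of terms and by the traces of [B] and its square
    ([local_spectrum]), hence by the intersection numbers, [theta_1] and
    [theta_d]: up to a nonzero factor it is the difference of the two sides
    of the tautness equation ([taut_defect_identity]). The vertex [x] has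
    disappeared, so one vertex is as good as all of them. The factor
    contains [b_2 - 1], and [b_2 > 1] is a divisibility argument
    ([bnum2_gt1]).

    The inequalities [theta_1^2 > b_2 > theta_d^2] come from the signs of
    two traces: with [M = (k^2 - A^2)^2 (A^2 - b_2)], the trace of [M] is
    negative and that of [A^2 M] is positive, so at some eigenvalues the
    corresponding polynomials take values of these signs. To recognise
    [theta_d] as an eigenvalue of smallest absolute value one needs that the
    spectrum is symmetric about zero and has exactly [D + 1] elements. *)

(** * Spectra of real symmetric matrices *)

(** The spectral theorem over the complex numbers yields real eigenvalues,
    so the minimal polynomial, which does not change under extension of
    scalars, has simple roots, all of them in [R]. *)
Lemma sym_diagonalizable (R : rcfType) n (B : 'M[R]_n) : B^T = B ->
  exists2 P, P \in unitmx & exists d, P *m B = diag_mx d *m P.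
Proof.
case: n B => [|n] B symB.
  by exists 1%:M; rewrite ?unitmx1 //; exists 0; rewrite !flatmx0.
pose f : {rmorphism R -> complex R} := real_complex R.
have realB : map_mx f B \is a mxOver Num.real.
  apply/mxOverP => i j; rewrite mxE; apply/complex_realP.
  by exists (B i j).
have hermB : map_mx f B \is hermsymmx.
  apply: realsym_hermsym => //; apply/is_hermitianmxP.
  rewrite expr0 scale1r -{1}symB; by apply/matrixP => i j; rewrite !mxE.
have spec := orthomx_spectralP (hermitian_normalmx hermB).
have dreal := hermitian_spectral_diag_real hermB.
set Q := spectralmx _ in spec; set d := spectral_diag _ in spec dreal.
have Qu : Q \in unitmx by exact: spectral_unit.
have dgB : diagonalizable_for Q (map_mx f B).
  apply/diagonalizable_forPex; exists d; apply/simmxP => //.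
  by rewrite {1}spec !mulmxA mulmxV // mul1mx.
have := diagonalizable_for_mxminpoly Qu dgB.
set rs := undup _ => minE.
have rsE : {in rs, forall a, exists b, a = f b}.
  move=> a; rewrite mem_undup => /mapP [i _ ->].
  have -> : mxpoly.conjmx Q (map_mx f B) = diag_mx d.
    by rewrite mxpoly.conjumx // {1}spec !mulmxA mulmxV // mul1mx -mulmxA
      mulmxV // mulmx1.
  by rewrite mxE eqxx mulr1n; apply/complex_realP/(mxOverP dreal).
pose rs0 := [seq complex.Re a | a <- rs].
have rs0E : map f rs0 = rs.
  rewrite -map_comp -[RHS]map_id; apply/eq_in_map => a /rsE [b ->] //=.
have /diagonalizableP [P Pu] : exists2 rs, uniq rs & mxminpoly B %| \prod_(x <-
  rs) ('X - x%:P).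
  exists rs0; first by rewrite -(map_inj_uniq (fmorph_inj f)) rs0E undup_uniq.
  rewrite -(dvdp_map f) -mxminpoly_map minE rmorph_prod /= -rs0E big_map.
  by rewrite (eq_bigr _ (fun i _ => map_polyXsubC f i)) dvdpp.
move=> /diagonalizable_forPex [d' /(simmxP Pu) e].
by exists P => //; exists d'.
Qed.

(** The rows of [P] are eigenvectors of [B], with eigenvalues [f]. Keeping
    [P] fixed lets polynomial expressions in one matrix be diagonalized
    together. *)
Definition diag_in (F : fieldType) n (P B : 'M[F]_n) (f : 'I_n -> F) :=
  P *m B = diag_mx (\row_i f i) *m P.

Section DiagIn.
Variables (F : fieldType) (n : nat) (P : 'M[F]_n) (Pu : P \in unitmx).
Implicit Types (B M : 'M[F]_n) (f g : 'I_n -> F).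

Lemma diag_inM B M f g :
  diag_in P B f -> diag_in P M g -> diag_in P (B *m M) (fun i => f i * g i).
Proof.
rewrite /diag_in => hB hM; rewrite mulmxA hB -mulmxA hM mulmxA; congr (_ *m _).
by rewrite mulmx_diag; congr diag_mx; apply/rowP => i; rewrite !mxE.
Qed.

Lemma diag_in_scalar a : diag_in P a%:M (fun=> a).
Proof.
rewrite /diag_in scalar_mxC; congr (_ *m _).
by apply/matrixP => i j; rewrite !mxE; case: eqP.
Qed.

Lemma diag_inD B M f g :
  diag_in P B f -> diag_in P M g -> diag_in P (B + M) (fun i => f i + g i).
Proof.
rewrite /diag_in => hB hM; rewrite mulmxDr hB hM -mulmxDl -raddfD.
by congr (diag_mx _ *m _); apply/rowP => i; rewrite !mxE.
Qed.

Lemma diag_inN B f : diag_in P B f -> diag_in P (- B) (fun i => - f i).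
Proof.
rewrite /diag_in => hB; rewrite mulmxN hB -mulNmx -raddfN.
by congr (diag_mx _ *m _); apply/rowP => i; rewrite !mxE.
Qed.

Lemma mxtrace_diag_in B f : diag_in P B f -> \tr B = \sum_i f i.
Proof.
move=> hB; rewrite -[B]mul1mx -(mulVmx Pu) -mulmxA hB mxtrace_mulC -mulmxA.
rewrite mulmxV // mulmx1 mxtrace_diag.
by apply: eq_bigr => i _; rewrite mxE.
Qed.

Lemma diag_in_inj B M f : diag_in P B f -> diag_in P M f -> B = M.
Proof. by move=> hB hM; apply: (can_inj (mulKmx Pu)); rewrite hB hM. Qed.

Lemma char_poly_diag_in B f :
  diag_in P B f -> char_poly B = \prod_i ('X - (f i)%:P).
Proof.
move=> hB; set D := diag_mx (\row_i f i) in hB.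
have <- : char_poly D = \prod_i ('X - (f i)%:P).
  rewrite char_poly_trig ?diag_mx_is_trig //.
  by apply: eq_bigr => i _; rewrite !mxE eqxx mulr1n.
have : \det (map_mx polyC P) != 0.
  by rewrite det_map_mx polyC_eq0 -unitfE -unitmxE.
move/mulfI; apply; rewrite /char_poly [RHS]mulrC -!det_mulmx; congr (\det _).
by rewrite /char_poly_mx mulmxBr mulmxBl -!map_mxM hB scalar_mxC.
Qed.

Lemma mxrank_diag f : \rank (diag_mx (\row_i f i)) = #|[set i | f i != 0]|.
Proof.
set D := diag_mx _; set S := [set i | _].
(* [M] selects the rows in [S]; [D] factors through it, and its compression by
   [M] is invertible. *)
pose M : 'M[F]_(#|S|, n) := rowsub (fun j : 'I_#|S| => enum_val j) 1%:M.
have DE : D = D *m M^T *m M.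
  apply/matrixP => i j; rewrite -mulmxA mul_diag_mx !mxE.
  have [iS|iS] := boolP (i \in S); last first.
    by move: iS; rewrite inE negbK => /eqP ->; rewrite mul0r mul0rn.
  rewrite (bigD1 (enum_rank_in iS i)) //= big1 => [|l nl]; rewrite ?mxE.
    by rewrite enum_rankK_in // eqxx mul1r addr0 mulr_natr.
  have [vi|_] := eqVneq (enum_val l) i; last by rewrite mul0r.
  by case/eqP: nl; apply: enum_val_inj; rewrite enum_rankK_in.
apply/eqP; rewrite eqn_leq; apply/andP; split.
  by rewrite DE (leq_trans (mxrankM_maxr _ _)) ?rank_leq_row.
have U : M *m D *m M^T = diag_mx (\row_j f (enum_val j)).
  apply/matrixP => i j; rewrite mul_mx_diag !mxE (bigD1 (enum_val i)) //=.
  rewrite big1 => [|l /negPf nl]; last first; rewrite ?mxE.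
    by rewrite eq_sym nl !mul0r.
  rewrite eqxx mul1r addr0 (inj_eq enum_val_inj) eq_sym.
  by case: eqP; rewrite ?mulr1 ?mulr0.
have <- : \rank (M *m D *m M^T) = #|S|.
  apply/eqP; rewrite -[_ == _]/(row_free _) row_free_unit unitmxE unitfE U
    det_diag.
  apply/prodf_neq0 => i _; rewrite mxE.
  by have := enum_valP i; rewrite inE.
by rewrite (leq_trans (mxrankM_maxl _ _)) ?mxrankM_maxr.
Qed.

Lemma mxrank_eigenspace_diag_in B f a :
  diag_in P B f -> \rank (eigenspace B a) = #|[set i | f i == a]|.
Proof.
move=> hB; have hBa := diag_inD hB (diag_inN (diag_in_scalar a)).
have rkP : \rank (B - a%:M) = \rank (P *m (B - a%:M)).
  by rewrite -[RHS]mxrank_tr trmx_mul mxrankMfree ?mxrank_tr // row_free_unit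
    unitmx_tr.
rewrite /eigenspace mxrank_ker {}rkP hBa mxrankMfree ?row_free_unit //.
rewrite mxrank_diag -{1}[n]card_ord.
rewrite -(cardsC [set i | f i == a]).
rewrite [X in (_ - X)%N](_ : _ = #|~: [set i | f i == a]|) ?addnK //.
by apply: eq_card => i; rewrite !inE subr_eq0.
Qed.

End DiagIn.

(** Since [B] is diagonalizable, multiplicities are dimensions of
    eigenspaces. The map [u |-> u *m v^T] vanishes on every eigenspace but
    the one of [lam], where its rank is one; so cutting the eigenspaces with
    the orthogonal complement of [v] amounts to removing one copy of [lam]. *)
Lemma sym_spectrum (R : rcfType) n (B : 'M[R]_n) (v : 'rV[R]_n) lam :
    B^T = B -> v != 0 -> v *m B = lam *: v ->
  exists s : seq R,
    [/\ char_poly B = \prod_(a <- lam :: s) ('X - a%:P),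
        forall a, count_mem a s = \rank (eigenspace B a :&: kermx v^T)%MS,
        \sum_(a <- lam :: s) a = \tr B
      & \sum_(a <- lam :: s) a ^+ 2 = \tr (B *m B)].
Proof.
move=> symB v0 vB; have [P Pu [d hd]] := sym_diagonalizable symB.
pose f i := d 0 i; have hB : diag_in P B f.
  by rewrite /diag_in hd; congr (diag_mx _ *m _); apply/rowP => i; rewrite mxE.
pose s := [seq f i | i <- enum 'I_n].
have countE a : count_mem a s = \rank (eigenspace B a).
  rewrite (mxrank_eigenspace_diag_in Pu a hB) cardE size_filter count_map.
  by rewrite -enumT; apply: eq_count => i; rewrite !inE.
have vE : (v <= eigenspace B lam)%MS by apply/eigenspaceP.
have lams : lam \in s.
  rewrite -has_pred1 has_count countE lt0n mxrank_eq0.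
  by apply: contraNneq v0 => E0; move: vE; rewrite E0 submx0.
(* The map [u |-> u *m v^T] on the eigenspace of [a] *)
have rkEv a : \rank (eigenspace B a *m v^T) = (a == lam).
  have [->|neq] := eqVneq a lam; last first.
    apply/eqP; rewrite mxrank_eq0; have /eigenspaceP hE :=
      submx_refl (eigenspace B a).
    have : (a - lam) *: (eigenspace B a *m v^T) = 0.
      rewrite scalerBl scalemxAl -hE -mulmxA -{2}symB -trmx_mul vB linearZ /=.
      by rewrite -scalemxAr subrr.
    by move/eqP; rewrite scaler_eq0 subr_eq0 (negPf neq).
  apply/eqP; rewrite eqn_leq rank_leq_col lt0n mxrank_eq0.
  have : (v *m v^T <= eigenspace B lam *m v^T)%MS by rewrite submxMr.
  apply: contraTneq => ->; apply: contra v0 => /submx0null/matrixP /(_ 0 0).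
  rewrite !mxE => /eqP; rewrite psumr_eq0 => [/allP h|i _];
    last by rewrite mxE -expr2 sqr_ge0.
  apply/eqP/rowP => i; apply/eqP; move: (h i (mem_index_enum i)).
  by rewrite !mxE mulf_eq0 orbb.
have perm_s : perm_eq (lam :: rem lam s) s by rewrite perm_sym perm_to_rem.
exists (rem lam s); split.
- by rewrite (perm_big _ perm_s) /= big_map big_enum -(char_poly_diag_in Pu hB).
- move=> a; rewrite count_rem countE lams /=.
  by rewrite -(mxrank_mul_ker (eigenspace B a) v^T) rkEv eq_sym addKn.
- by rewrite (perm_big _ perm_s) /= big_map big_enum -(mxtrace_diag_in Pu hB).
- rewrite (perm_big _ perm_s) /= big_map big_enum.
  by rewrite (mxtrace_diag_in Pu (diag_inM hB hB)).
Qed.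

(** * Distance in bipartite graphs *)

Section Distance.
Variables (X : finType) (e : rel X).
Hypothesis hgraph : simple_connected_graph e.

Let e_sym : symmetric e. Proof. by case: hgraph. Qed.
Let e_irr : irreflexive e. Proof. by case: hgraph. Qed.
Let e_conn x y : connect e x y. Proof. by case: hgraph. Qed.

Lemma walk0 x y : walk e 0 x y = (x == y).
Proof.
apply/existsP/eqP => [[s]|->]; first by rewrite tuple0 /= => /eqP.
by exists [tuple]; rewrite /= eqxx.
Qed.

Lemma walkP n x y :
  reflect (exists s, [/\ size s = n, path e x s & last x s = y]) (walk e n x y).
Proof.
apply: (iffP existsP) => [[s /andP [ps /eqP ls]]|[s [ss ps ls]]].
  by exists s; rewrite size_tuple.
by exists (tcast ss (in_tuple s)); rewrite /= val_tcast ps ls eqxx.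
Qed.

Lemma walkS n x z : walk e n.+1 x z = [exists y, walk e n x y && e y z].
Proof.
apply/walkP/existsP => [[s]|[y /andP [/walkP [s [ss ps ls]] yz]]].
  case/lastP: s => [|s w] []; first by [].
  rewrite size_rcons last_rcons rcons_path => -[ss] /andP [ps lw] <-.
  by exists (last x s); rewrite lw andbT; apply/walkP; exists s.
exists (rcons s z); split; rewrite ?size_rcons ?ss ?last_rcons //.
by rewrite rcons_path ps ls.
Qed.

Lemma walk_cat m n x y z : walk e m x y -> walk e n y z -> walk e (m + n) x z.
Proof.
elim: n z => [|n IH] z wm; first by rewrite walk0 addn0 => /eqP <-.
rewrite walkS => /existsP [w /andP [wn wz]].
by rewrite addnS walkS; apply/existsP; exists w; rewrite IH.
Qed.

Lemma walk1 x y : walk e 1 x y = e x y.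
Proof.
rewrite walkS; apply/existsP/idP => [[z]|xy].
  by rewrite walk0 => /andP [/eqP ->].
by exists x; rewrite walk0 eqxx.
Qed.

Lemma walk_sym n x y : walk e n x y -> walk e n y x.
Proof.
elim: n y => [|n IH] y; first by rewrite !walk0 eq_sym.
rewrite walkS => /existsP [z /andP [wz zy]]; rewrite -add1n.
by apply: (walk_cat (y := z)); rewrite ?walk1 1?e_sym // IH.
Qed.

Lemma walk_dist x y : walk e (dist e x y) x y.
Proof.
have : has (fun n => walk e n x y) (iota 0 #|X|).
  have /connectP [s ps ->] := e_conn x y.
  case/shortenP: ps => s' ps' us' _; apply/hasP; exists (size s').
    rewrite mem_iota /= add0n.
    by have := max_card (mem (x :: s')); rewrite (card_uniqP us').
  by apply/walkP; exists s'.
move=> hw; have := nth_find 0%N hw; rewrite nth_iota ?add0n //.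
by rewrite -[X in (_ < X)%N](size_iota 0) -has_find.
Qed.

Lemma dist_le n x y : walk e n x y -> (dist e x y <= n)%N.
Proof.
move=> w; have [nX|nX] := ltnP n #|X|; last first.
  by apply: leq_trans nX; rewrite -[X in (_ <= X)%N](size_iota 0) find_size.
rewrite leqNgt; apply/negP => lt.
by have := before_find 0%N lt; rewrite nth_iota ?w.
Qed.

Lemma dist_eq0 x y : (dist e x y == 0%N) = (x == y).
Proof.
apply/eqP/eqP => [d0|->]; first by have := walk_dist x y;
  rewrite d0 walk0 => /eqP.
by apply/eqP; rewrite -leqn0 dist_le ?walk0.
Qed.

Lemma distxx x : dist e x x = 0%N.
Proof. by apply/eqP; rewrite dist_eq0. Qed.

Lemma dist_sym x y : dist e x y = dist e y x.
Proof.
by apply/eqP; rewrite eqn_leq !dist_le //; apply/walk_sym/walk_dist.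
Qed.

Lemma dist_triangle y x z : (dist e x z <= dist e x y + dist e y z)%N.
Proof. by apply: dist_le; apply: walk_cat (walk_dist _ _) (walk_dist _ _). Qed.

Lemma dist_eq1 x y : (dist e x y == 1%N) = e x y.
Proof.
apply/eqP/idP => [d1|xy]; first by have := walk_dist x y; rewrite d1 walk1.
apply/eqP; rewrite eqn_leq dist_le ?walk1 //= lt0n dist_eq0.
by apply: contraTneq xy => ->; rewrite e_irr.
Qed.

Lemma dist_pred n x y :
  dist e x y = n.+1 -> exists z, dist e x z = 1%N /\ dist e z y = n.
Proof.
move=> d; have := walk_dist y x; rewrite -dist_sym d walkS.
case/existsP => z /andP [wz zx]; exists z.
have d1 : dist e x z = 1%N by apply/eqP; rewrite dist_eq1 e_sym.
split=> //; apply/eqP; rewrite eqn_leq dist_le ?(walk_sym wz) //=.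
by have := dist_triangle z x y; rewrite d d1.
Qed.

Lemma dist_diameter x y : (dist e x y <= diameter e)%N.
Proof.
by apply: leq_trans (leq_bigmax x); apply: (leq_bigmax (F := fun y =>
  dist e x y)).
Qed.

Lemma dist_onto h :
  (0 < diameter e)%N -> (h <= diameter e)%N -> exists x y, dist e x y = h.
Proof.
move=> D0; have [x [y xyD]] : exists x y, dist e x y = diameter e.
  have X0 : (0 < #|X|)%N.
    apply: contraTltn D0; rewrite leqn0 => /eqP/card0_eq X0.
    by rewrite /diameter big_pred0 // => x; have := X0 x.
  have [x Dx] := bigop.eq_bigmax (fun x => \max_y dist e x y)%N X0.
  have [y Dy] := bigop.eq_bigmax (dist e x) X0; exists x, y.
  by rewrite /diameter Dx Dy.
move=> hD; rewrite -(subKn hD); elim: (diameter e - h)%N => [|m [x' [y' IH]]].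
  by exists x, y; rewrite subn0.
have [m_D|m_D] := ltnP m (diameter e).
  move: IH; rewrite -[(_ - m)%N]prednK ?subn_gt0 // => /dist_pred [z [_ zy]].
  by exists z, y'; rewrite zy subnS.
by exists x, x; rewrite distxx; apply/esym/eqP; rewrite subn_eq0 ltnW.
Qed.

(** Along a walk the colour changes at every step, so the parity of its
    length tells whether its ends have the same colour. *)
Lemma odd_dist y x z : bipartite e ->
  odd (dist e x z) = odd (dist e x y) (+) odd (dist e y z).
Proof.
case=> A [hA hA'].
have eA u v : e u v -> (v \in A) = (u \notin A).
  move=> uv; apply/idP/idP => [vA|uA].
    by apply/negP => uA; have := hA u v uA vA; rewrite uv.
  by apply/negPn/negP => vA; have := hA' u v uA vA; rewrite uv.
have wA n u v : walk e n u v -> odd n = ((u \in A) (+) (v \in A)).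
  elim: n v => [|n IH] v; first by rewrite walk0 => /eqP ->; rewrite addbb.
  rewrite walkS => /existsP [w /andP [/IH oddn /eA ->]].
  by rewrite /= oddn addbN.
rewrite !(wA _ _ _ (walk_dist _ _)).
by case: (x \in A); case: (y \in A); case: (z \in A).
Qed.

End Distance.

(** * Intersection numbers *)

Record bipartite_drg (X : finType) (e : rel X) (p : nat -> nat -> nat -> nat) :
    Prop := BipartiteDrg {
  drg_graph : simple_connected_graph e;
  drg_bipartite : bipartite e;
  drg_regular : distance_regular e p;
  drg_diameter : (4 <= diameter e)%N;
  drg_valency : (3 <= valency p)%N }.

Section IntersectionNumbers.
Variables (X : finType) (e : rel X).
Variable p : nat -> nat -> nat -> nat.
Hypothesis hG : bipartite_drg e p.
Let hgraph : simple_connected_graph e := drg_graph hG.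
Let hbip : bipartite e := drg_bipartite hG.
Let hdrg : distance_regular e p := drg_regular hG.
Let hD : (4 <= diameter e)%N := drg_diameter hG.
Let hk : (3 <= valency p)%N := drg_valency hG.

Local Notation D := (diameter e).
Local Notation dist := (dist e).
Local Notation k := (valency p).
Local Notation c := (cnum p).
Local Notation b := (bnum p).

Let D0 : (0 < D)%N. Proof. exact: leq_trans hD. Qed.

Lemma card_pE x y i j : (i <= D)%N -> (j <= D)%N ->
  #|[set z | (dist x z == i) && (dist z y == j)]| = p (dist x y) i j.
Proof. by move=> iD jD; apply: hdrg; rewrite ?dist_diameter. Qed.

Lemma card_dist x y h i j : dist x y = h -> (i <= D)%N -> (j <= D)%N ->
  #|[set z | (dist x z == i) && (dist z y == j)]| = p h i j.
Proof. by move=> <-; exact: card_pE. Qed.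

Lemma card_sphere x i : (i <= D)%N -> #|[set z | dist x z == i]| = p 0 i i.
Proof.
move=> iD; rewrite -(distxx hgraph x) -card_pE //; apply: eq_card => z.
by rewrite !inE (dist_sym hgraph z) andbb.
Qed.

Lemma valencyE : k = p 0 1 1. Proof. by []. Qed.

Lemma card_nbr x : #|[set z | dist x z == 1%N]| = k.
Proof. exact: card_sphere. Qed.

(** The distances to [y] from the ends of an edge differ by at most one and
    have opposite parities. *)
Lemma dist_nbr x y z : dist x z = 1%N ->
  dist z y = (dist x y).+1 \/ dist x y = (dist z y).+1.
Proof.
move=> xz; have := odd_dist hgraph z x y hbip; rewrite xz /=.
have := dist_triangle hgraph z x y; have := dist_triangle hgraph x z y.
rewrite (dist_sym hgraph z x) xz; case: (ltngtP (dist z y) (dist x y)).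
- by move=> *; right; lia.
- by move=> *; left; lia.
- by move=> -> _ _; case: odd.
Qed.

Lemma p1_eq0 h j : (h <= D)%N -> (j <= D)%N -> j != h.+1 -> h != j.+1 ->
  p h 1 j = 0%N.
Proof.
move=> hhD jD jh hj; have [x [y xy]] := dist_onto hgraph D0 hhD.
rewrite -xy -card_pE //; apply/eqP; rewrite cards_eq0; apply/eqP/setP => z.
rewrite !inE; apply/negP => /andP [/eqP xz /eqP zy].
by have := dist_nbr y xz; rewrite zy xy => -[] E; rewrite E eqxx in jh hj.
Qed.

Lemma cnum_gt0 h : (0 < h <= D)%N -> (0 < c h)%N.
Proof.
case/andP => h0 hhD; have [x [y xy]] := dist_onto hgraph D0 hhD.
rewrite /cnum -xy -card_pE ?xy; [|by []|by rewrite (leq_trans (leq_pred _))].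
have [z [xz zy]] := dist_pred hgraph (etrans xy (esym (prednK h0))).
by apply/card_gt0P; exists z; rewrite inE xz zy !eqxx.
Qed.

Lemma bnum_gt0 h : (h < D)%N -> (0 < b h)%N.
Proof.
move=> hhD; have [x [y xy]] := dist_onto hgraph D0 hhD.
have [z [xz zy]] := dist_pred hgraph xy.
rewrite /bnum -zy -card_pE ?zy //.
by apply/card_gt0P; exists x; rewrite inE (dist_sym hgraph) xz xy !eqxx.
Qed.

Lemma cb_valency h : (0 < h < D)%N -> (c h + b h)%N = k.
Proof.
case/andP => h0 hhD; have [x [y xy]] := dist_onto hgraph D0 (ltnW hhD).
have h1D : (h.-1 <= D)%N by rewrite (leq_trans (leq_pred _)) // ltnW.
rewrite -(card_nbr x) /cnum /bnum -xy -!card_pE ?xy // -cardsUI.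
rewrite [X in (_ + X)%N](_ : _ = 0%N) ?addn0; last first.
  by apply/eqP; rewrite cards_eq0; apply/eqP/setP => z; rewrite !inE; lia.
apply: eq_card => z; rewrite !inE -andb_orr; case: eqP => //= xz.
by have [E|E] := dist_nbr y xz; rewrite xy in E; apply/orP; [right|left]; lia.
Qed.

Lemma cnum1 : c 1 = 1%N.
Proof.
have [x [y xy]] := dist_onto hgraph D0 D0.
rewrite /cnum /= -{1}xy -card_pE // -[RHS](cards1 y); apply: eq_card => z.
rewrite !inE (dist_eq0 hgraph) andbC; have [->|//] := eqVneq z y.
by rewrite xy.
Qed.

Lemma bnum1 : (b 1).+1 = k.
Proof. by rewrite -(@cb_valency 1) ?cnum1 //; lia. Qed.

(** If [dist x y = 3] and [w] is a neighbour of [x] at distance 2 from [y],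
    then the common neighbours of [w] and [y] are neighbours of [y] at
    distance 2 from [x]. *)
Lemma cnum2_le3 : (c 2 <= c 3)%N.
Proof.
have D3 : (3 <= D)%N by exact: leq_trans hD.
have [x [y xy]] := dist_onto hgraph D0 D3.
have [w [xw wy]] := dist_pred hgraph xy.
have p_swap u v : #|[set z | (dist u z == 1%N) && (dist z v == (dist u v).-1)]|
  = c (dist u v).
  by rewrite card_pE // (leq_trans (leq_pred _)) ?dist_diameter.
have yx : dist y x = 3 by rewrite (dist_sym hgraph).
have yw : dist y w = 2 by rewrite (dist_sym hgraph).
have := p_swap y x; have := p_swap y w; rewrite yx yw /= => <- <-.
apply/subset_leq_card/subsetP => z; rewrite !inE => /andP [/eqP yz /eqP zw].
rewrite yz eqxx /=; have := dist_nbr x yz; rewrite yx.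
by have := dist_triangle hgraph w z x; rewrite zw (dist_sym hgraph w) xw; lia.
Qed.

Lemma nbr_sum (R : pzRingType) (q : nat -> R) x y :
  \sum_(z | dist x z == 1%N) q (dist z y) =
  \sum_(i < D.+1) (p (dist x y) 1 i)%:R * q i.
Proof.
rewrite (partition_big (fun z => inord (dist z y) : 'I_D.+1) xpredT) //=.
apply: eq_bigr => i _; rewrite -card_pE // ?[(i <= D)%N]ltn_ord //; last first.
  by rewrite -ltnS ltn_ord.
rewrite (eq_bigr (fun=> q i)) => [|z /andP [_ /eqP <-]]; last first.
  by rewrite inordK // ltnS dist_diameter.
rewrite sumr_const mulr_natl; congr (_ *+ _); apply: eq_card => z; rewrite !inE.
by congr (_ && _); rewrite -val_eqE /= inordK // ltnS dist_diameter.
Qed.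

Lemma sum_p1 (R : pzRingType) (q : nat -> R) h : (0 < h < D)%N ->
  \sum_(i < D.+1) (p h 1 i)%:R * q i = (c h)%:R * q h.-1 + (b h)%:R * q h.+1.
Proof.
case/andP => h0 hhD.
have h1 : (h.-1 < D.+1)%N by lia.
have h2 : (h.+1 < D.+1)%N by lia.
rewrite (bigD1 (Ordinal h1)) //= (bigD1 (Ordinal h2)) /=; last first.
  by rewrite -val_eqE /=; lia.
rewrite addrA big1 ?addr0 // => i; rewrite -!val_eqE /= => /andP [n1 n2].
by rewrite p1_eq0 ?mul0r //; have := ltn_ord i; lia.
Qed.

Lemma sum_p1_0 (R : pzRingType) (q : nat -> R) :
  \sum_(i < D.+1) (p 0 1 i)%:R * q i = k%:R * q 1%N.
Proof.
have h1 : (1 < D.+1)%N by lia.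
rewrite (bigD1 (Ordinal h1)) //= big1 ?addr0 // => i;
  rewrite -!val_eqE /= => n1.
by rewrite p1_eq0 ?mul0r //; have := ltn_ord i; lia.
Qed.

Lemma sum_p1_D (R : pzRingType) (q : nat -> R) :
  \sum_(i < D.+1) (p D 1 i)%:R * q i = (c D)%:R * q D.-1.
Proof.
have h1 : (D.-1 < D.+1)%N by lia.
rewrite (bigD1 (Ordinal h1)) //= big1 ?addr0 // => i;
  rewrite -!val_eqE /= => n1.
by rewrite p1_eq0 ?mul0r //; have := ltn_ord i; lia.
Qed.

End IntersectionNumbers.

(** * The Bose-Mesner algebra *)

Section BoseMesner.
Variables (R : rcfType) (X : finType) (e : rel X).
Variable p : nat -> nat -> nat -> nat.
Hypothesis hG : bipartite_drg e p.
Let hgraph : simple_connected_graph e := drg_graph hG.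
Let hbip : bipartite e := drg_bipartite hG.
Let hdrg : distance_regular e p := drg_regular hG.
Let hD : (4 <= diameter e)%N := drg_diameter hG.
Let hk : (3 <= valency p)%N := drg_valency hG.

Local Notation D := (diameter e).
Local Notation dist := (dist e).
Local Notation k := (valency p).
Local Notation c := (cnum p).
Local Notation b := (bnum p).
Local Notation A := (adjmx R [set: X] e).

(** The Bose-Mesner algebra consists of these matrices; only the values of
    [q] up to the diameter matter. *)
Definition dmx (q : nat -> R) : 'M[R]_#|[set: X]| :=
  \matrix_(i, j) q (dist (enum_val i) (enum_val j)).

(** Multiplication by the adjacency matrix, on distance coefficients. *)
Definition nbr_op (q : nat -> R) (h : nat) : R :=
  \sum_(i < D.+1) (p h 1 i)%:R * q i.

Lemma sum_vertices (F : X -> R) :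
  \sum_(i < #|[set: X]|) F (enum_val i) = \sum_x F x.
Proof.
by rewrite -big_enum_val; apply: eq_bigl => x; rewrite inE.
Qed.

Lemma dmx_ext q q' : (forall h, (h <= D)%N -> q h = q' h) -> dmx q = dmx q'.
Proof. by move=> h; apply/matrixP => i j; rewrite !mxE h ?dist_diameter. Qed.

Lemma dmx_inj q q' : dmx q = dmx q' -> forall h, (h <= D)%N -> q h = q' h.
Proof.
move=> eqq h hhD; have [x [y <-]] := dist_onto hgraph (leq_trans (isT : 0 <
  4)%N hD) hhD.
have xT (z : X) : z \in [set: X] by rewrite inE.
move/matrixP/(_ (enum_rank_in (xT x) x) (enum_rank_in (xT y) y)): eqq.
by rewrite !mxE !enum_rankK_in ?inE.
Qed.

Lemma mul_dmxE q q' i j :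
  (dmx q *m dmx q') i j =
  \sum_z q (dist (enum_val i) z) * q' (dist z (enum_val j)).
Proof. by rewrite mxE -sum_vertices; apply: eq_bigr => l _; rewrite !mxE. Qed.

Lemma adjmx_dmx : A = dmx (fun h => (h == 1%N)%:R).
Proof. by apply/matrixP => i j; rewrite !mxE (dist_eq1 hgraph). Qed.

Lemma scalar_dmx a : a%:M = dmx (fun h => a * (h == 0%N)%:R).
Proof.
apply/matrixP => i j; rewrite !mxE (dist_eq0 hgraph) (inj_eq enum_val_inj).
by rewrite mulr_natr.
Qed.

Lemma dmxD q q' : dmx q + dmx q' = dmx (fun h => q h + q' h).
Proof. by apply/matrixP => i j; rewrite !mxE. Qed.

Lemma scale_dmx a q : a *: dmx q = dmx (fun h => a * q h).
Proof. by apply/matrixP => i j; rewrite !mxE. Qed.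

Lemma mul_adjmx_dmx q : A *m dmx q = dmx (nbr_op q).
Proof.
rewrite adjmx_dmx; apply/matrixP => i j; rewrite mul_dmxE mxE /nbr_op.
rewrite -(nbr_sum hG) [RHS]big_mkcond /=; apply: eq_bigr => z _.
by case: eqP; rewrite ?mul1r ?mul0r.
Qed.

Lemma mxtrace_dmx q : \tr (dmx q) = #|X|%:R * q 0%N.
Proof.
rewrite /mxtrace (eq_bigr (fun=> q 0%N)) => [|i _];
  last by rewrite mxE (distxx hgraph).
by rewrite sumr_const card_ord cardsT mulr_natl.
Qed.

Lemma adjmx_sym : A^T = A.
Proof.
by rewrite adjmx_dmx; apply/matrixP => i j; rewrite !mxE (dist_sym hgraph).
Qed.

Lemma adjmx_diag : exists2 P, P \in unitmx & exists f, diag_in P A f.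
Proof.
have [P Pu [d hd]] := sym_diagonalizable adjmx_sym; exists P => //;
  exists (d 0).
by rewrite /diag_in hd; congr (diag_mx _ *m _); apply/rowP => i; rewrite mxE.
Qed.

Lemma eigenvalue_diag_in P f t : P \in unitmx -> diag_in P A f ->
  reflect (exists i, f i = t) (eigenvalue A t).
Proof.
move=> Pu hf; rewrite /eigenvalue -mxrank_eq0 -lt0n.
rewrite (mxrank_eigenspace_diag_in Pu t hf).
apply: (iffP card_gt0P) => -[j]; first by rewrite inE => /eqP; exists j.
by move=> <-; exists j; rewrite inE.
Qed.

(** The distance coefficients of a polynomial in the adjacency matrix,
    computed by Horner's rule. *)
Fixpoint poly_coeffs (s : seq R) : nat -> R :=
  if s is a :: s' then fun h => nbr_op (poly_coeffs s') h + a * (h == 0%N)%:R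
  else fun=> 0.

Lemma diag_in_poly P f (g : {poly R}) : P \in unitmx -> diag_in P A f ->
  diag_in P (dmx (poly_coeffs g)) (fun i => g.[f i]).
Proof.
move=> Pu hf; rewrite /horner; elim: (polyseq g) => [|a s IH] /=.
  suff -> : dmx (fun=> 0) = 0%:M by exact: diag_in_scalar.
  by rewrite scalar_dmx; apply: dmx_ext => h _; rewrite mul0r.
rewrite -dmxD -mul_adjmx_dmx -scalar_dmx.
have := diag_inD (diag_inM hf IH) (diag_in_scalar P a).
rewrite /diag_in => ->; congr (diag_mx _ *m _); apply/rowP => i.
by rewrite !mxE mulrC.
Qed.

(** Vertices at distance [h] are joined by no walk of fewer than [h] steps,
    and by [c_1 * ... * c_h] walks of [h] steps. *)
Lemma poly_coeffs_top s h : (h <= D)%N -> (size s <= h.+1)%N ->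
  poly_coeffs s h = (\prod_(j < h) c j.+1)%:R * s`_h.
Proof.
elim: s h => [|a s IH] h hhD; first by rewrite nth_nil mulr0.
rewrite /= ltnS => hs; case: h => [|h] in hhD hs *.
  move: hs; rewrite leqn0 size_eq0 => /eqP -> /=.
  rewrite big_ord0 mul1r mulr1 /nbr_op big1 ?add0r // => i _.
  by rewrite mulr0.
rewrite mulr0 addr0 /nbr_op.
have h1 : (h < D.+1)%N by lia.
rewrite (bigD1 (Ordinal h1)) //= big1 ?addr0 => [|i]; last first.
  rewrite -val_eqE /= => n1; have iD := ltn_ord i.
  have [ih|ih] := ltnP i h.
    by rewrite (p1_eq0 hG) ?mul0r //; lia.
  rewrite IH; [|lia|lia]; rewrite [s`_i]nth_default ?mulr0 //.
  apply: leq_trans hs _; lia.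
rewrite IH; [|lia|lia]; rewrite big_ord_recr /= natrM -mulrA mulrCA mulrA.
by rewrite [_ * (c _)%:R]mulrC.
Qed.

(** The primitive idempotent of an eigenvalue is a polynomial in the
    adjacency matrix by Lagrange interpolation, so its entries depend on the
    distance only. *)
Lemma primitive_idempotent t : eigenvalue A t ->
  exists q : nat -> R,
    [/\ 0 < q 0%N,
        forall x y, \sum_z q (dist x z) * q (dist z y) = q (dist x y)
      & forall h, (h <= D)%N -> nbr_op q h = t * q h].
Proof.
have [P Pu [f hf]] := adjmx_diag; case/(eigenvalue_diag_in t Pu hf) => i0 fi0.
(* Lagrange interpolation of the indicator of [t] on the spectrum *)
pose rs := [seq a <- codom f | a != t].
pose g0 : {poly R} := \prod_(a <- rs) ('X - a%:P).
have g0t : g0.[t] != 0.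
  rewrite -[_ == _]/(root _ _) root_prod_XsubC mem_filter eqxx //.
pose g := (g0.[t])^-1 *: g0; pose q := poly_coeffs g.
have hE : diag_in P (dmx q) (fun i => (f i == t)%:R).
  have := diag_in_poly g Pu hf; rewrite -/q /diag_in => ->.
  congr (diag_mx _ *m _); apply/rowP => i; rewrite !mxE hornerZ.
  have [->|ne] := eqVneq; first by rewrite mulVf.
  suff /rootP -> : root g0 (f i) by rewrite mulr0.
  by rewrite root_prod_XsubC mem_filter ne codom_f.
exists q; split.
- have : 0 < \tr (dmx q).
    rewrite (mxtrace_diag_in Pu hE) (bigD1 i0) //= fi0 eqxx.
    by rewrite ltr_pwDl ?ltr01 // sumr_ge0 // => i _; rewrite ler0n.
  by rewrite mxtrace_dmx => h; rewrite -(pmulr_rgt0 _ (x := #|X|%:R)) //;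
    move: h; case: #|X| => [|n _]; rewrite ?mul0r ?ltxx ?ltr0n.
- move=> x y; have xT (z : X) : z \in [set: X] by rewrite inE.
  have : dmx q *m dmx q = dmx q.
    apply: (diag_in_inj Pu _ hE); have := diag_inM hE hE.
    rewrite /diag_in => ->; congr (diag_mx _ *m _); apply/rowP => i.
    by rewrite !mxE; case: eqP; rewrite ?mulr1 ?mulr0.
  move/matrixP/(_ (enum_rank_in (xT x) x) (enum_rank_in (xT y) y)).
  by rewrite mul_dmxE mxE !enum_rankK_in ?inE.
- apply: dmx_inj; rewrite -mul_adjmx_dmx -scale_dmx -mul_scalar_mx.
  apply: (diag_in_inj Pu (diag_inM hf hE)).
  have := diag_inM (diag_in_scalar P t) hE.
  rewrite /diag_in => ->; congr (diag_mx _ *m _); apply/rowP => i.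
  by rewrite !mxE; case: eqP => [->|]; rewrite ?mulr0.
Qed.

(** An idempotent symmetric [E] equals [E *m E^T], so its quadratic form is
    a sum of squares. Indexing by a family [g] of vertices allows
    restriction to a subset. *)
Lemma idempotent_psd (q : nat -> R) (I : finType) (g : I -> X) (v : I -> R) :
    (forall x y, \sum_z q (dist x z) * q (dist z y) = q (dist x y)) ->
  0 <= \sum_i \sum_j v i * v j * q (dist (g i) (g j)).
Proof.
move=> hq; have -> : \sum_i \sum_j v i * v j * q (dist (g i) (g j)) =
    \sum_z (\sum_i v i * q (dist (g i) z)) ^+ 2.
  under eq_bigr => i _ do under eq_bigr => j _ do rewrite -hq mulr_sumr.
  under eq_bigr => i _ do rewrite exchange_big.
  rewrite exchange_big; apply: eq_bigr => z _; rewrite expr2 mulr_suml.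
  apply: eq_bigr => i _; rewrite mulr_sumr; apply: eq_bigr => j _.
  by rewrite (dist_sym hgraph z); ring.
by apply: sumr_ge0 => z _; exact: sqr_ge0.
Qed.

End BoseMesner.

(** * The spectrum of the graph *)

Section Spectrum.
Variables (R : rcfType) (X : finType) (e : rel X).
Variable p : nat -> nat -> nat -> nat.
Hypothesis hG : bipartite_drg e p.
Let hgraph : simple_connected_graph e := drg_graph hG.
Let hbip : bipartite e := drg_bipartite hG.
Let hdrg : distance_regular e p := drg_regular hG.
Let hD : (4 <= diameter e)%N := drg_diameter hG.
Let hk : (3 <= valency p)%N := drg_valency hG.

Local Notation D := (diameter e).
Local Notation dist := (dist e).
Local Notation k := (valency p).
Local Notation c := (cnum p).
Local Notation b := (bnum p).
Local Notation A := (adjmx R [set: X] e).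
Local Notation dmx := (dmx e).
Local Notation nbr_op := (nbr_op e p).

Let D0 : (0 < D)%N. Proof. exact: leq_trans hD. Qed.

(** The form of the idempotent of [t] on two adjacent vertices, with weights
    [1] and [-1] or [1] and [1]. *)
Lemma eigenvalue_norm t : eigenvalue A t -> `|t| <= k%:R.
Proof.
case/(primitive_idempotent hG) => q [q0 qq qt].
have := qt 0%N isT; rewrite /nbr_op (sum_p1_0 hG) => E1.
have [x [y xy]] := dist_onto hgraph D0 D0.
have psd s : 0 <= (1 + s ^+ 2) * q 0%N + s *+ 2 * q 1%N.
  have := idempotent_psd hG (fun i : bool => if i then x else y)
           (fun i : bool => if i then 1 else s) qq.
  rewrite !big_bool /= !(distxx hgraph) (dist_sym hgraph y) xy => h.
  by apply: le_trans h _; rewrite le_eqVlt; apply/orP; left; apply/eqP; ring.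
have := psd 1; have := psd (-1); rewrite sqrrN expr1n => hm hp.
rewrite -(ler_pM2r q0) -{1}(gtr0_norm q0) -normrM -E1 normrM (ger0_norm (ler0n
  _ _)).
by rewrite ler_wpM2l ?ler0n // ler_norml; apply/andP; split; lra.
Qed.

Lemma eigenvalue_valency : eigenvalue A k%:R.
Proof.
have [x [_ _]] := dist_onto hgraph D0 (leq0n D).
apply/eigenvalueP; exists (const_mx 1).
  apply/rowP => j; rewrite !mxE mulr1.
  transitivity (\sum_z (e z (enum_val j))%:R : R).
    rewrite -(sum_vertices (fun z => (e z (enum_val j))%:R)).
    by apply: eq_bigr => i _; rewrite !mxE mul1r.
  rewrite -(card_nbr hG (enum_val j)) -sum1dep_card natr_sum [RHS]big_mkcond /=.
  apply: eq_bigr => z _; rewrite (dist_eq1 hgraph).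
  by have [-> _ _] := hgraph; case: (e _ z).
apply/eqP => /rowP /(_ (enum_rank_in (in_setT x) x)) /eqP.
by rewrite !mxE oner_eq0.
Qed.

(** Negating an eigenvector on one colour class negates its eigenvalue. *)
Lemma eigenvalueN t : eigenvalue A t -> eigenvalue A (- t).
Proof.
case/eigenvalueP => v vA v0; case: (hbip) => Y [hY hY'].
pose sg (x : X) : R := (-1) ^+ (x \in Y).
have sgE i j : A i j * sg (enum_val i) = - sg (enum_val j) * A i j.
  rewrite mxE /sg; case eij: (e _ _); last by rewrite mul0r mulr0.
  rewrite mul1r mulr1; case iY: (_ \in Y); case jY: (_ \in Y).
  - by have := hY _ _ iY jY; rewrite eij.
  - by rewrite expr0.
  - by rewrite expr0 opprK.
  - by have := hY' _ _ (negbT iY) (negbT jY); rewrite eij.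
apply/eigenvalueP; exists (\row_i (v 0 i * sg (enum_val i))).
  apply/rowP => j; rewrite !mxE.
  have := congr1 (fun w : 'rV_ _ => w 0 j) vA; rewrite !mxE => E.
  transitivity (- sg (enum_val j) * \sum_i v 0 i * A i j); last by rewrite E;
    ring.
  rewrite mulr_sumr; apply: eq_bigr => i _.
  by rewrite mxE -mulrA [sg _ * _]mulrC sgE; ring.
apply: contraNneq v0 => w0; apply/eqP/rowP => i; move/rowP/(_ i)/eqP: w0.
by rewrite !mxE mulf_eq0 signr_eq0 orbF => /eqP.
Qed.

Local Notation ev := (eigenvalues R e).

Lemma eigenvalues_uniq : uniq ev.
Proof. 
have := eigenvalues_decreasing R e.
by rewrite /eigenvalues rev_sorted rev_uniq => /lt_sorted_uniq. Qed.

(** An eigenvalue is a root of the polynomial obtained by running the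
    three-term recurrence of its idempotent up to distance [D], of degree [D
    + 1]. *)
Lemma size_eigenvalues_le : (size ev <= D.+1)%N.
Proof.
have [v hv] : exists v : nat -> {poly R}, forall h, (h < D)%N ->
    [/\ size (v h) = h.+1, size (v h.+1) = h.+2 &
     forall t q, (forall h, (h <= D)%N -> nbr_op q h = t * q h) ->
       q h = (v h).[t] * q 0%N /\ q h.+1 = (v h.+1).[t] * q 0%N].
  (* [w h] is the pair of [v h] and [v h.+1]. *)
  pose step h (uw : {poly R} * {poly R}) :=
    (uw.2, ((b h.+1)%:R)^-1 *: ('X * uw.2 - (c h.+1)%:R *: uw.1)).
  pose w h := iteri h step (1, (k%:R)^-1 *: 'X).
  have wE h : (w h.+1).1 = (w h).2 by [].
  have k0 : (k%:R : R) != 0 by rewrite pnatr_eq0; lia.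
  exists (fun h => (w h).1) => h; rewrite wE.
  elim: h => [|h IH] hhD.
    rewrite /w /= size_poly1 size_scale ?invr_eq0 // size_polyX;
      split=> // t q hq.
    rewrite hornerC mul1r hornerZ hornerX; split => //.
    have := hq 0%N isT; rewrite /nbr_op (sum_p1_0 hG) => E1.
    by rewrite -mulrA -E1 mulKf.
  have [s1 s2 hq] := IH (ltnW hhD).
  have b0 : ((b h.+1)%:R : R) != 0.
    by rewrite pnatr_eq0 -lt0n (bnum_gt0 hG).
  have w0 : (w h).2 != 0 by rewrite -size_poly_eq0 s2.
  rewrite wE; split => //=.
    rewrite size_scale ?invr_eq0 // mulrC size_polyDl ?size_mulX // s2 //.
    by rewrite size_polyN (leq_ltn_trans (size_scale_leq _ _)) // s1.
  move=> t q hq'; have [q1 q2] := hq t q hq'; split => //.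
  have := hq' h.+1 (ltnW hhD); rewrite /nbr_op (sum_p1 hG) //=.
  rewrite !hornerE q1 q2 => E; apply: (mulfI b0).
  rewrite -[_^-1 * _ * _]mulrA mulVKf //.
  by apply: (addrI ((c h.+1)%:R * ((w h).1.[t] * q 0%N))); rewrite E; ring.
have [s1 s2 hq] := hv D.-1 (ltac:(lia)).
rewrite prednK // in s2 hq; pose g := 'X * v D - (c D)%:R *: v D.-1.
have v0 : v D != 0 by rewrite -size_poly_eq0 s2.
have sg : size g = D.+2.
  rewrite /g mulrC size_polyDl ?size_mulX // s2 //.
  by rewrite size_polyN (leq_ltn_trans (size_scale_leq _ _)) // s1; lia.
rewrite -ltnS -sg; apply: max_poly_roots; rewrite ?eigenvalues_uniq //.
  by rewrite -size_poly_eq0 sg.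
apply/allP => t; rewrite mem_eigenvalues.
case/(primitive_idempotent hG) => q [q0 qq qt].
have := qt D (leqnn D); rewrite /nbr_op (sum_p1_D hG) => E.
have [q1 q2] := hq t q qt; apply/rootP; apply: (mulIf (lt0r_neq0 q0)).
rewrite q1 q2 in E; by rewrite /g !hornerE mulrBl -!mulrA E subrr.
Qed.

(** The monic polynomial with the eigenvalues as simple roots annihilates
    [A]; if its degree were a distance, it would have a nonzero coefficient
    at that distance. *)
Lemma size_eigenvalues_ge : (D < size ev)%N.
Proof.
rewrite ltnNge; apply/negP => sz.
have [P Pu [f hf]] := adjmx_diag R hG.
pose g : {poly R} := \prod_(a <- ev) ('X - a%:P).
have : dmx (poly_coeffs e p g) = dmx (fun=> 0).
  apply: (diag_in_inj Pu (diag_in_poly hG _ Pu hf)).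
  rewrite -[dmx (fun=> 0)](_ : 0%:M = _); last first.
    by rewrite (scalar_dmx hG); apply: dmx_ext => h _; rewrite mul0r.
  have := diag_in_scalar P (0 : R).
  rewrite /diag_in => ->; congr (diag_mx _ *m _); apply/rowP => i; rewrite !mxE.
  apply/esym/rootP; rewrite root_prod_XsubC mem_eigenvalues.
  by apply/(eigenvalue_diag_in _ Pu hf); exists i.
move/(dmx_inj hG)/(_ (size ev) sz).
rewrite (poly_coeffs_top hG) ?size_prod_XsubC //.
have := monic_prod_XsubC ev xpredT id; rewrite monicE lead_coefE
  size_prod_XsubC /=.
move/eqP => ->; rewrite mulr1 => /eqP; rewrite pnatr_eq0 -leqn0 leqNgt.
rewrite prodn_gt0 // => j; rewrite (cnum_gt0 hG) //.
by rewrite /= (leq_trans (ltn_ord j)).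
Qed.

Lemma size_eigenvalues : size ev = D.+1.
Proof. by apply/eqP; rewrite eqn_leq size_eigenvalues_le size_eigenvalues_ge.
  Qed.

End Spectrum.

(** * Comparison of the eigenvalues with the second intersection number *)

Section ExtremalEigenvalues.
Variables (R : rcfType) (X : finType) (e : rel X).
Variable p : nat -> nat -> nat -> nat.
Hypothesis hG : bipartite_drg e p.
Let hgraph : simple_connected_graph e := drg_graph hG.
Let hbip : bipartite e := drg_bipartite hG.
Let hdrg : distance_regular e p := drg_regular hG.
Let hD : (4 <= diameter e)%N := drg_diameter hG.
Let hk : (3 <= valency p)%N := drg_valency hG.

Local Notation D := (diameter e).
Local Notation dist := (dist e).
Local Notation k := (valency p).
Local Notation c := (cnum p).
Local Notation b := (bnum p).
Local Notation A := (adjmx R [set: X] e).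
Local Notation ev := (eigenvalues R e).
Local Notation Adist i := (dmx e (fun h => (h == i)%:R : R)).

Let D0 : (0 < D)%N. Proof. exact: leq_trans hD. Qed.

Lemma mul_adjmx_dist i : (0 < i < D)%N ->
  A *m Adist i = (b i.-1)%:R *: Adist i.-1 + (c i.+1)%:R *: Adist i.+1.
Proof.
case/andP => i0 iD; rewrite (mul_adjmx_dmx hG) !scale_dmx dmxD.
apply: dmx_ext => h hhD; rewrite /nbr_op.
have i1 : (i < D.+1)%N by lia.
rewrite (bigD1 (Ordinal i1)) //= big1 => [|j]; last first.
  by rewrite -val_eqE /= => /negPf ->; rewrite mulr0.
rewrite eqxx mulr1 addr0.
have [->|n1] := eqVneq h i.-1.
  by rewrite /bnum prednK // mulr1 (_ : (_ == _) = false) ?mulr0 ?addr0 //; lia.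
have [->|n2] := eqVneq h i.+1; first by rewrite mulr1 mulr0 add0r.
by rewrite !mulr0 addr0 (p1_eq0 hG) //; lia.
Qed.

Lemma mxtrace_mul_dmx (q q' : nat -> R) :
  \tr (dmx e q *m dmx e q') = \sum_x \sum_z q (dist x z) * q' (dist x z).
Proof.
rewrite -sum_vertices; apply: eq_bigr => i _; rewrite mul_dmxE.
by apply: eq_bigr => z _; rewrite (dist_sym hgraph z).
Qed.

Lemma mxtrace_dist_neq i j : i != j -> \tr (Adist i *m Adist j) = 0.
Proof.
move=> ij; rewrite mxtrace_mul_dmx big1 // => x _; rewrite big1 // => z _.
by have [->|_] := eqVneq (dist x z) i; rewrite ?(negPf ij) ?mulr0 ?mul0r.
Qed.

Lemma mxtrace_dist_gt0 i : (i <= D)%N -> 0 < \tr (Adist i *m Adist i).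
Proof.
move=> iD; have [x [y xy]] := dist_onto hgraph D0 iD.
have ge0 u : 0 <= \sum_z ((dist u z == i)%:R * (dist u z == i)%:R : R).
  by apply: sumr_ge0 => z _; rewrite -natrM ler0n.
rewrite mxtrace_mul_dmx (bigD1 x) //= ltr_pwDl ?sumr_ge0 // (bigD1 y) //= xy
  eqxx.
by rewrite ltr_pwDl ?mulr1 // sumr_ge0 // => z _; rewrite -natrM ler0n.
Qed.

Lemma natr_valency1 : (k%:R : R) = 1 + (b 1)%:R.
Proof. by rewrite -(bnum1 hG) -add1n natrD. Qed.

Lemma natr_valency h : (0 < h < D)%N -> (k%:R : R) = (c h)%:R + (b h)%:R.
Proof. by move=> hh; rewrite -(cb_valency hG hh) natrD. Qed.

Let k1 := natr_valency1.
Let k2 : (k%:R : R) = (c 2)%:R + (b 2)%:R. Proof. by apply: natr_valency;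
  lia. Qed.
Let k3 : (k%:R : R) = (c 3)%:R + (b 3)%:R. Proof. by apply: natr_valency;
  lia. Qed.

Let A1 : A = Adist 1. Proof. exact: (adjmx_dmx R hG). Qed.
Let A0 : 1%:M = Adist 0.
Proof. by rewrite (scalar_dmx hG); apply: dmx_ext => h _; rewrite mul1r. Qed.

Let AA1 : A *m Adist 1 = k%:R *: Adist 0 + (c 2)%:R *: Adist 2.
Proof. by rewrite mul_adjmx_dist ?valencyE //; lia. Qed.
Let AA2 : A *m Adist 2 = (b 1)%:R *: Adist 1 + (c 3)%:R *: Adist 3.
Proof. by rewrite mul_adjmx_dist //; lia. Qed.
Let AA3 : A *m Adist 3 = (b 2)%:R *: Adist 2 + (c 4)%:R *: Adist 4.
Proof. by rewrite mul_adjmx_dist //; lia. Qed.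

(** Written in terms of the distance matrices, [k^2 - A^2] and its products
    with [A^2] and [A^2 - b_2] have few terms, and products of different
    distance matrices are traceless. *)
Let M1 : 'M[R]_#|[set: X]| := (k%:R ^+ 2)%:M - A *m A.
Let M3 : 'M[R]_#|[set: X]| := A *m (A *m M1).
Let M2 : 'M[R]_#|[set: X]| := M3 - ((b 2)%:R)%:M *m M1.

Let M1E : M1 = (k%:R * (b 1)%:R) *: Adist 0 - (c 2)%:R *: Adist 2.
Proof.
rewrite /M1 {2}A1 AA1 -scalemx1 A0; apply/matrixP => i j; rewrite !mxE.
by rewrite k1; ring.
Qed.

Let M3E : M3 = (k%:R * (b 1)%:R * (b 2)%:R) *: Adist 0
   + ((c 2)%:R * (b 2)%:R * ((b 3)%:R - 1)) *: Adist 2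
   - ((c 2)%:R * (c 3)%:R * (c 4)%:R) *: Adist 4.
Proof.
have AM1 : A *m M1 = (k%:R * (b 1)%:R) *: Adist 1 -
    (c 2)%:R *: ((b 1)%:R *: Adist 1 + (c 3)%:R *: Adist 3).
  by rewrite M1E mulmxBr -!scalemxAr AA2 -A0 mulmx1 A1.
rewrite /M3 AM1 mulmxBr -!scalemxAr mulmxDr -!scalemxAr AA1 AA3.
apply/matrixP => i j; rewrite !mxE.
have -> : (b 3)%:R = k%:R - (c 3)%:R :> R by rewrite k3; ring.
have -> : (b 1)%:R = k%:R - 1 :> R by rewrite k1; ring.
by rewrite k2; ring.
Qed.

Let M2E : M2 = ((b 2)%:R * (b 3)%:R * (c 2)%:R) *: Adist 2
   - ((c 2)%:R * (c 3)%:R * (c 4)%:R) *: Adist 4.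
Proof.
rewrite /M2 M3E M1E mul_scalar_mx; apply/matrixP => i j; rewrite !mxE.
by ring.
Qed.

Lemma natr_cnum_gt0 h : (0 < h <= D)%N -> 0 < (c h)%:R :> R.
Proof. by move=> hh; rewrite ltr0n (cnum_gt0 hG). Qed.

Lemma natr_bnum_ge1 h : (h < D)%N -> 1 <= (b h)%:R :> R.
Proof. by move=> hh; rewrite ler1n (bnum_gt0 hG). Qed.

Let trE (x0 x2 x4 y2 y4 : R) :
  \tr ((x0 *: Adist 0 + x2 *: Adist 2 - x4 *: Adist 4) *m (y2 *: Adist 2 - y4
    *: Adist 4)) =
  x2 * y2 * \tr (Adist 2 *m Adist 2) + x4 * y4 * \tr (Adist 4 *m Adist 4).
Proof.
rewrite !mulmxBr !mulmxBl !mulmxDl -!scalemxAl -!scalemxAr.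
rewrite !(raddfB, raddfD, linearZ) /= !linearZ /=.
rewrite (@mxtrace_dist_neq 0 2) // (@mxtrace_dist_neq 0 4) //.
by rewrite (@mxtrace_dist_neq 2 4) // (@mxtrace_dist_neq 4 2) //; ring.
Qed.

Let M_diag P f (g := fun i => k%:R ^+ 2 - f i * f i) : diag_in P A f ->
  [/\ diag_in P M1 g, diag_in P M3 (fun i => f i * (f i * g i))
    & diag_in P M2 (fun i => f i * (f i * g i) - (b 2)%:R * g i)].
Proof.
move=> hf.
have d1 := diag_inD (diag_in_scalar P (k%:R ^+ 2)) (diag_inN (diag_inM hf hf)).
have d3 := diag_inM hf (diag_inM hf d1); split => //.
exact: diag_inD d3 (diag_inN (diag_inM (diag_in_scalar _ _) d1)).
Qed.

(** The trace of [(k^2 - A^2)^2 (A^2 - b_2)] is negative, so [(k^2 - t^2)^2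
    (t^2 - b_2)] is negative for some eigenvalue [t]. *)
Lemma exists_small_eigenvalue : exists2 t, eigenvalue A t & t ^+ 2 < (b 2)%:R.
Proof.
have [P Pu [f hf]] := adjmx_diag R hG.
have [d1 d3 d2] := M_diag hf.
have tr_lt : \tr (M1 *m M2) < 0.
  have -> : M1 = (k%:R * (b 1)%:R) *: Adist 0 + (- (c 2)%:R) *: Adist 2 - 0 *:
    Adist 4.
    by rewrite M1E scale0r subr0 scaleNr.
  rewrite M2E trE mul0r mul0r addr0 mulNr mulNr oppr_lt0.
  have := natr_bnum_ge1 (ltac:(lia) : (2 < D)%N).
  have := natr_bnum_ge1 (ltac:(lia) : (3 < D)%N) => *.
  by rewrite !mulr_gt0 ?natr_cnum_gt0 ?mxtrace_dist_gt0 //; (lra || lia).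
have [/existsP [j hj]|/existsPn h] := boolP [exists i, f i ^+ 2 < (b 2)%:R].
  by exists (f j) => //; apply/(eigenvalue_diag_in _ Pu hf); exists j.
move: tr_lt; rewrite (mxtrace_diag_in Pu (diag_inM d1 d2)) ltNge sumr_ge0 // =>
  i _.
rewrite [X in 0 <= X](_ : _ = (k%:R ^+ 2 - f i * f i) ^+ 2 * (f i ^+ 2 - (b
  2)%:R)); last by ring.
by rewrite mulr_ge0 ?sqr_ge0 // subr_ge0 leNgt.
Qed.

(** The trace of [A^2 (k^2 - A^2)^2 (A^2 - b_2)] is positive, so [t^2 (k^2 -
    t^2)^2 (t^2 - b_2)] is positive for some eigenvalue [t]. *)
Lemma exists_large_eigenvalue :
  exists2 t, eigenvalue A t & (b 2)%:R < t ^+ 2 /\ t ^+ 2 != k%:R ^+ 2.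
Proof.
have [P Pu [f hf]] := adjmx_diag R hG.
have [d1 d3 d2] := M_diag hf.
have tr_gt : 0 < \tr (M3 *m M2).
  rewrite M2E M3E trE.
  have := natr_bnum_ge1 (ltac:(lia) : (2 < D)%N).
  have := natr_bnum_ge1 (ltac:(lia) : (3 < D)%N) => *.
  rewrite ltr_wpDl //; first by rewrite !mulr_ge0 ?subr_ge0 ?ler0n // ltW
    ?mxtrace_dist_gt0 //; lia.
  by rewrite !mulr_gt0 ?natr_cnum_gt0 ?mxtrace_dist_gt0 //; lia.
have [/existsP [j /andP [h1 h2]]|/existsPn h] :=
    boolP [exists i, ((b 2)%:R < f i ^+ 2) && (f i ^+ 2 != k%:R ^+ 2)].
  by exists (f j) => //; apply/(eigenvalue_diag_in _ Pu hf); exists j.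
move: tr_gt; rewrite (mxtrace_diag_in Pu (diag_inM d3 d2)) ltNge sumr_le0 // =>
  i _.
rewrite [X in X <= 0](_ : _ = (f i * (k%:R ^+ 2 - f i * f i)) ^+ 2 * (f i ^+ 2
  - (b 2)%:R)); last by ring.
have := h i; rewrite negb_and -leNgt negbK => /orP [h1|/eqP h1].
  by rewrite mulr_ge0_le0 ?sqr_ge0 // subr_le0.
by rewrite -h1 -expr2 subrr mulr0 expr0n mul0r.
Qed.

Lemma mxtrace_distE i : (i <= D)%N ->
  \tr (Adist i *m Adist i) = #|X|%:R * (knum p i)%:R.
Proof.
move=> iD; rewrite mxtrace_mul_dmx (eq_bigr (fun=> (knum p i)%:R)) => [|x _].
  by rewrite sumr_const mulr_natl.
rewrite /knum -(card_sphere hG x iD) -sum1dep_card natr_sum [RHS]big_mkcond /=.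
by apply: eq_bigr => z _; case: eqP; rewrite ?mulr1 ?mulr0.
Qed.

(** The trace of [A^2 A_2], with [A^2] or [A A_2] expanded first. *)
Lemma natr_knum2 : (c 2)%:R * (knum p 2)%:R = k%:R * (b 1)%:R :> R.
Proof.
have X0 : (#|X|%:R : R) != 0.
  have [x _] := dist_onto hgraph D0 (leq0n D).
  by rewrite pnatr_eq0 -lt0n; apply/card_gt0P; exists x.
have E1 : \tr (A *m A *m Adist 2) = (c 2)%:R * \tr (Adist 2 *m Adist 2).
  rewrite {2}A1 AA1 mulmxDl -!scalemxAl mxtraceD !mxtraceZ.
  by rewrite (@mxtrace_dist_neq 0 2) // mulr0 add0r.
have E2 : \tr (A *m A *m Adist 2) = (b 1)%:R * \tr (Adist 1 *m Adist 1).
  rewrite -mulmxA AA2 mulmxDr -!scalemxAr mxtraceD !mxtraceZ A1.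
  by rewrite (@mxtrace_dist_neq 1 3) // mulr0 addr0.
apply: (mulfI X0); have := etrans (esym E1) E2.
rewrite (mxtrace_distE (ltac:(lia) : (2 <= D)%N)) (mxtrace_distE (ltac:(lia) :
  (1 <= D)%N)).
by rewrite mulrCA => ->; rewrite mulrCA [_ * (b 1)%:R]mulrC.
Qed.

(** The coefficient of [A^2 A_2] at distance 2, with [A^2] or [A A_2]
    expanded first. *)
Lemma natr_p222 :
  (c 2)%:R * (p 2 2 2)%:R + k%:R = (b 1)%:R * (c 2)%:R + (c 3)%:R * (b 2)%:R :>
    R.
Proof.
have [x [y xy]] := dist_onto hgraph D0 (ltac:(lia) : (2 <= D)%N).
pose i := enum_rank_in (in_setT x) x; pose j := enum_rank_in (in_setT x) y.
have : (A *m A *m Adist 2) i j = (A *m (A *m Adist 2)) i j by rewrite mulmxA.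
rewrite {2}A1 AA1 mulmxDl -!scalemxAl -A0 mul1mx AA2 mulmxDr -!scalemxAr AA1
  AA3.
have ei : enum_val i = x by rewrite enum_rankK_in ?inE.
have ej : enum_val j = y by rewrite enum_rankK_in ?inE.
have e2 : (Adist 2 *m Adist 2) i j = (p 2 2 2)%:R.
  rewrite mul_dmxE ei ej.
  have <- : #|[set z | (dist x z == 2) && (dist z y == 2)]| = p 2 2 2.
    by rewrite (card_pE hG) ?xy //; lia.
  rewrite -sum1dep_card natr_sum [RHS]big_mkcond /=.
  by apply: eq_bigr => z _; rewrite -natrM mulnb; case: andP.
have eD M N : (M + N : 'M[R]__) i j = M i j + N i j by rewrite mxE.
have eZ a M : (a *: M : 'M[R]__) i j = a * M i j by rewrite mxE.
have eA l : Adist l i j = (2 == l)%:R by rewrite mxE ei ej xy.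
by rewrite !(eD, eZ) e2 !eA /=; lra.
Qed.

End ExtremalEigenvalues.

Section ThetaBounds.
Variables (R : rcfType) (X : finType) (e : rel X).
Variable p : nat -> nat -> nat -> nat.
Hypothesis hG : bipartite_drg e p.
Let hD : (4 <= diameter e)%N := drg_diameter hG.
Let hk : (3 <= valency p)%N := drg_valency hG.

Local Notation D := (diameter e).
Local Notation k := (valency p).
Local Notation b := (bnum p).
Local Notation A := (adjmx R [set: X] e).
Local Notation ev := (eigenvalues R e).
Local Notation theta := (theta R e).

Let szE : size ev = D.+1. Proof. exact: (size_eigenvalues R hG). Qed.

Lemma theta_decr i j : (j <= D)%N -> (i < j)%N -> theta j < theta i.
Proof.
move=> jD ij; have gt_tr : transitive (>%R : rel R) by move=> y x z xy yz;
  exact: lt_trans yz xy.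
apply: (sorted_ltn_nth gt_tr 0 (eigenvalues_decreasing R e)) => //.
  by rewrite inE szE; lia.
by rewrite inE szE; lia.
Qed.

Lemma theta_eigenvalue i : (i <= D)%N -> eigenvalue A (theta i).
Proof. by move=> iD; rewrite -mem_eigenvalues mem_nth // szE. Qed.

Lemma eigenvalue_theta t : eigenvalue A t -> exists2 i, (i <= D)%N & t =
  theta i.
Proof.
rewrite -mem_eigenvalues => /(nthP 0) [j]; rewrite szE => jD <-.
by exists j.
Qed.

(** Reversing and negating the list of eigenvalues gives a decreasing list
    with the same elements. *)
Lemma theta_opp i : (i <= D)%N -> theta i = - theta (D - i).
Proof.
move=> iD; have evE : ev = map -%R (rev ev).
  have gt_tr : transitive (>%R : rel R) by move=> y x z xy yz;
    exact: lt_trans yz xy.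
  apply: (irr_sorted_eq gt_tr (@ltxx _ R)); first exact: eigenvalues_decreasing.
    have := eigenvalues_decreasing R e; rewrite sorted_map (rev_sorted _ ev).
    by apply: sub_sorted => x y /=; rewrite ltrN2.
  move=> t; rewrite -{2}(opprK t) (mem_map oppr_inj) (mem_rev ev)
    !mem_eigenvalues.
  by apply/idP/idP => /(eigenvalueN hG) ; rewrite ?opprK.
have := congr1 (nth 0 ^~ i) evE; rewrite /= (nth_map 0) ?(size_rev ev) ?szE //.
by rewrite (nth_rev _ (s := ev)) ?szE // subSS.
Qed.

(** The absolute value of an eigenvalue given by [exists_large_eigenvalue]
    is an eigenvalue below [theta_0 = k], hence at most [theta_1]. *)
Lemma theta1_bounds : (b 2)%:R < theta 1 ^+ 2 < k%:R ^+ 2.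
Proof.
have [t tA [tb tk]] := exists_large_eigenvalue R hG.
have tk' : `|t| < k%:R.
  rewrite lt_neqAle (eigenvalue_norm hG tA) andbT; apply: contraNneq tk => <-.
  by rewrite real_normK ?num_real.
have [|i iD ti] := @eigenvalue_theta `|t|.
  by have [_|_] := ger0P t => //; exact: (eigenvalueN hG).
have k0 : k%:R <= theta 0.
  have [[|j] jD ->] := eigenvalue_theta (eigenvalue_valency R hG); first by [].
  by rewrite ltW // theta_decr.
have i0 : (0 < i)%N.
  by rewrite lt0n; apply: contraTneq tk' => i0; rewrite -leNgt ti i0.
have t1 : `|t| <= theta 1.
  rewrite ti; have [->//|i1] := eqVneq i 1%N.
  by rewrite ltW // theta_decr //; lia.
have t1k : theta 1 < k%:R.
  have : theta 1 < theta 0 by rewrite theta_decr //; lia.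
  have := eigenvalue_norm hG (theta_eigenvalue (leq0n D)).
  by move=> h1 h2; apply: lt_le_trans h2 (le_trans (ler_norm _) h1).
have t0 : 0 <= theta 1 by apply: le_trans t1.
rewrite (ltrXn2r 2 t0 t1k) andbT (lt_le_trans tb) //.
by rewrite -(real_normK (num_real t)) lerXn2r ?nnegrE.
Qed.

(** As [theta_i = - theta_(D - i)] and [d] is the integral half of [D], the
    nonnegative eigenvalues are [theta_0, ..., theta_d], so [theta_d] has
    the smallest absolute value. *)
Lemma thetad_bound : theta D./2 ^+ 2 < (b 2)%:R.
Proof.
have [t tA tb] := exists_small_eigenvalue R hG.
have [i iD ti] := eigenvalue_theta tA.
have dD : (D./2 <= D - D./2)%N by lia.
have mono u v : (v <= D)%N -> (u <= v)%N -> theta v <= theta u.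
  by move=> vD; rewrite leq_eqVlt => /orP [/eqP ->//|uv];
    rewrite ltW ?theta_decr.
have opp_d := @theta_opp D./2 (ltac:(lia)).
have d0 : 0 <= theta D./2.
  by have := mono _ _ (leq_subr _ _) dD; move: opp_d; lra.
apply: le_lt_trans tb; rewrite -[t ^+ 2](real_normK (num_real t)).
rewrite lerXn2r ?nnegrE //; rewrite ti.
have [le|gt] := leqP i D./2.
  by apply: le_trans (ler_norm _); apply: mono => //; lia.
rewrite -normrN; apply: le_trans (ler_norm _); rewrite opp_d lerN2.
by apply: mono => //; lia.
Qed.

End ThetaBounds.

(** * The second neighbourhood of a vertex *)

Section LocalGraph.
Variables (R : rcfType) (X : finType) (e : rel X).
Variable p : nat -> nat -> nat -> nat.
Hypothesis hG : bipartite_drg e p.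
Let hgraph : simple_connected_graph e := drg_graph hG.
Let hbip : bipartite e := drg_bipartite hG.
Let hD : (4 <= diameter e)%N := drg_diameter hG.
Let hk : (3 <= valency p)%N := drg_valency hG.
Variable x : X.

Local Notation D := (diameter e).
Local Notation dist := (dist e).
Local Notation k := (valency p).
Local Notation c := (cnum p).
Local Notation b := (bnum p).
Local Notation A := (adjmx R [set: X] e).
Local Notation S1 := [set y | dist x y == 1%N].
Local Notation S2 := [set y | dist x y == 2].
Local Notation B := (local_adjmx R e x).

(** The incidence matrix between neighbours of [x] and vertices at distance
    two from [x]. *)
Let N : 'M[R]_(#|S1|, #|S2|) := \matrix_(i, j) (dist (enum_val i) (enum_val j)
  == 1%N)%:R.

Let mem_S2 z : (z \in S2) = (dist x z == 2%N). Proof. by rewrite inE. Qed.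

Lemma sum_enum_val (S : {set X}) (F : X -> R) :
  \sum_(j < #|S|) F (enum_val j) = \sum_(z in S) F z.
Proof. by rewrite -big_enum_val. Qed.

Let sum_count (S : {set X}) (P : pred X) n :
  #|[set z in S | P z]| = n -> \sum_(z in S) (P z)%:R = n%:R :> R.
Proof.
move=> <-; rewrite -sum1dep_card natr_sum [RHS]big_mkcondr /=.
by apply: eq_bigr => z _; case: (P z).
Qed.

Lemma distS1 i : dist x (enum_val (i : 'I_#|S1|)) = 1%N.
Proof. by have := enum_valP i; rewrite inE => /eqP. Qed.

Lemma distS2 i : dist x (enum_val (i : 'I_#|S2|)) = 2%N.
Proof. by have := enum_valP i; rewrite inE => /eqP. Qed.

Lemma card_S2 : #|S2| = knum p 2.
Proof. by rewrite (card_sphere hG) //; lia. Qed.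

Lemma local_adjmxE i j : B i j = (dist (enum_val i) (enum_val j) == 2%N)%:R.
Proof. by rewrite mxE. Qed.

Lemma local_adjmx_sym : B^T = B.
Proof. by apply/matrixP => i j; rewrite mxE !local_adjmxE (dist_sym hgraph).
  Qed.

Lemma local_const_eigenvector :
  const_mx 1 *m B = (p 2 2 2)%:R *: (const_mx 1 : 'rV_#|S2|).
Proof.
apply/rowP => j; rewrite !mxE mulr1.
rewrite (eq_bigr (fun i => (dist (enum_val i) (enum_val j) == 2%N)%:R)) =>
  [|i _]; last first.
  by rewrite mxE mul1r local_adjmxE.
rewrite (sum_enum_val _ (fun z => (dist z (enum_val j) == 2%N)%:R));
  apply: sum_count.
rewrite -(card_dist hG (distS2 j)); [|lia|lia].
by apply: eq_card => z; rewrite !inE.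
Qed.

Lemma local_trace : \tr B = 0.
Proof. by rewrite /mxtrace big1 // => i _;
  rewrite local_adjmxE (distxx hgraph). Qed.

Lemma local_trace_sqr : \tr (B *m B) = (knum p 2)%:R * (p 2 2 2)%:R.
Proof.
rewrite /mxtrace (eq_bigr (fun=> (p 2 2 2)%:R)) => [|j _].
  by rewrite sumr_const card_ord card_S2 mulr_natl.
have := congr1 (fun v : 'rV_ _ => v 0 j) local_const_eigenvector.
rewrite !mxE mulr1 => <-; apply: eq_bigr => i _.
by rewrite [const_mx _ _ _]mxE mul1r !local_adjmxE (dist_sym hgraph) -natrM
  mulnb andbb.
Qed.

Let distS12 (i : 'I_#|S1|) (j : 'I_#|S2|) :
  dist (enum_val i) (enum_val j) = 1%N \/ dist (enum_val i) (enum_val j) = 3%N.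
Proof. by have := dist_nbr hG (enum_val j) (distS1 i); rewrite distS2; lia. Qed.

Let b2E : (b 2)%:R = k%:R - (c 2)%:R :> R.
Proof. by rewrite (@natr_valency R _ _ _ hG 2); [ring|lia]. Qed.
Let b3E : (b 3)%:R = k%:R - (c 3)%:R :> R.
Proof. by rewrite (@natr_valency R _ _ _ hG 3); [ring|lia]. Qed.
Let b1E : (b 1)%:R = k%:R - 1 :> R.
Proof. by rewrite (natr_valency1 R hG); ring. Qed.

(** For [y] adjacent to [x] and [z] at distance two from [x], the entry
    counts the neighbours [w] of [y], other than [x], with [dist w z = 2].
    If [y] and [z] are adjacent these are the [k - 2] neighbours of [y]
    other than [x] and [z]; otherwise [dist y z = 3] and there are [c_3 - 1]
    of them, [x] being one of the [c_3] neighbours of [y] at distance two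
    from [z]. *)
Lemma incidence_local :
  N *m B = ((b 3)%:R - 1) *: N + ((c 3)%:R - 1) *: const_mx 1.
Proof.
apply/matrixP => i j; rewrite !mxE mulr1.
set y := enum_val i; set z := enum_val j.
have xy : dist x y = 1%N by exact: distS1.
have yx : dist y x = 1%N by rewrite (dist_sym hgraph).
have xz : dist x z = 2%N by exact: distS2.
rewrite (eq_bigr (fun l => ((dist y (enum_val l) == 1%N) && (dist (enum_val l)
  z == 2%N))%:R)) => [|l _]; last first.
  by rewrite mxE local_adjmxE -natrM mulnb.
rewrite (sum_enum_val _ (fun w => ((dist y w == 1%N) && (dist w z == 2%N))%:R)).
have c3k : (c 3 <= k)%N by rewrite -(@cb_valency _ _ _ hG 3) ?leq_addr //; lia.
have c30 : (0 < c 3)%N by apply: (cnum_gt0 hG); lia.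
have [yz|yz] : dist y z = 1%N \/ dist y z = 3%N by exact: distS12.
  rewrite yz (@sum_count _ _ (k - 2)) ?eqxx; last first.
    rewrite -(card_nbr hG y) [in RHS](cardsD1 x) [in RHS](cardsD1 z) !inE yx yz
      /=.
    have -> : (z != x) by apply: contra_eq_neq xz => ->;
      rewrite (distxx hgraph).
    rewrite /= !add1n subn2 /=; apply: eq_card => w; rewrite in_set mem_S2 !inE.
    have [yw|yw] := eqVneq (dist y w) 1%N; last by rewrite !andbF.
    have wy : dist w y = 1%N by rewrite (dist_sym hgraph).
    rewrite !andbT /=.
    have := dist_nbr hG w xy; rewrite yw -(dist_eq0 hgraph w x) (dist_sym
      hgraph w x).
    have zy : dist z y = 1%N by rewrite (dist_sym hgraph).
    have := dist_nbr hG w zy; rewrite yw -(dist_eq0 hgraph w z) (dist_sym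
      hgraph z).
    by move=> [] h1 [] h2; rewrite ?h1 ?h2; lia.
  by rewrite b3E natrB /=; [ring|lia].
rewrite yz (@sum_count _ _ (c 3 - 1)) /=; last first.
  rewrite /cnum -(card_dist hG yz); [|lia|lia].
  rewrite [in RHS](cardsD1 x) !inE yx xz /= addKn; apply: eq_card => w;
    rewrite in_set mem_S2 !inE.
  have [yw|yw] := eqVneq (dist y w) 1%N; last by rewrite !andbF.
  have := dist_nbr hG w xy; rewrite yw -(dist_eq0 hgraph w x) (dist_sym hgraph
    w x).
  by move=> [] h1; rewrite ?h1 //=; lia.
by rewrite natrB // mulr0 add0r.
Qed.

Let N1 : N *m const_mx 1 = (b 1)%:R *: const_mx 1 :> 'cV_#|S1|.
Proof.
apply/colP => i; rewrite !mxE mulr1.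
rewrite (eq_bigr (fun l => (dist (enum_val i) (enum_val l) == 1%N)%:R)) =>
  [|l _]; last first.
  by rewrite !mxE mulr1.
rewrite (sum_enum_val _ (fun w => (dist (enum_val i) w == 1%N)%:R)).
apply: sum_count; have yx : dist (enum_val i) x =
  1%N by rewrite (dist_sym hgraph) distS1.
rewrite /bnum -(card_dist hG yx); [|lia|lia].
by apply: eq_card => w; rewrite in_set mem_S2 in_set andbC (dist_sym hgraph w).
Qed.

Let NNT : N *m N^T = (b 2)%:R%:M + ((c 2)%:R - 1) *: const_mx 1.
Proof.
apply/matrixP => i j; rewrite !mxE mulr1.
rewrite (eq_bigr (fun l => ((dist (enum_val i) (enum_val l) == 1%N) && (dist
  (enum_val j) (enum_val l) == 1%N))%:R)) => [|l _]; last first.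
  by rewrite !mxE -natrM mulnb.
rewrite (sum_enum_val _ (fun w => ((dist (enum_val i) w == 1%N) && (dist
  (enum_val j) w == 1%N))%:R)).
have [->|ij] := eqVneq i j.
  have := congr1 (fun v : 'cV_ _ => v j 0) N1; rewrite !mxE mulr1 b1E.
  rewrite (eq_bigr (fun l => (dist (enum_val j) (enum_val l) == 1%N)%:R)) =>
    [|l _]; last first.
    by rewrite !mxE mulr1.
  rewrite (sum_enum_val _ (fun w => (dist (enum_val j) w == 1%N)%:R)).
  under [in X in _ -> X]eq_bigr do rewrite andbb.
  by move=> ->; rewrite b2E mulr1n; ring.
have xi := distS1 i; have xj := distS1 j.
have ix : dist (enum_val i) x = 1%N by rewrite (dist_sym hgraph).
have dij : dist (enum_val i) (enum_val j) = 2%N.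
  have : dist (enum_val i) (enum_val j) != 0%N.
    by rewrite (dist_eq0 hgraph) (inj_eq enum_val_inj).
  by have := dist_nbr hG (enum_val j) ix; rewrite xj; lia.
rewrite mulr0n add0r (@sum_count _ _ (c 2 - 1)); last first.
  rewrite /cnum -(card_dist hG dij); [|lia|lia].
  rewrite [in RHS](cardsD1 x) !inE ix xj /= addKn; apply: eq_card => w;
    rewrite in_set mem_S2 !inE.
  rewrite (dist_sym hgraph w).
  have [iw|iw] := eqVneq (dist (enum_val i) w) 1%N; last by rewrite !andbF.
  have := dist_nbr hG w xi; rewrite iw -(dist_eq0 hgraph w x) (dist_sym hgraph
    w x).
  by move=> [] h1; rewrite ?h1 //=; lia.
by rewrite natrB // (cnum_gt0 hG) //; lia.
Qed.

Let const_mx1_mul m n :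
  const_mx 1 = (const_mx 1 : 'M[R]_(m, 1)) *m (const_mx 1 : 'M[R]_(1, n)).
Proof. by apply/matrixP => i j; rewrite !mxE big_ord1 !mxE mulr1. Qed.

(** On the zero-sum vectors [N *m N^T] is the scalar [b_2], and a vector
    killed by [N] has zero sum because the row sums of [N] are all [b_1]. *)
Let row_free_N : row_free N.
Proof.
rewrite -kermx_eq0; apply/rowV0P => u /sub_kermxP uN.
have b1_neq0 : (b 1)%:R != 0 :> R by rewrite pnatr_eq0 -lt0n (bnum_gt0 hG) //;
  lia.
have b2_neq0 : (b 2)%:R != 0 :> R by rewrite pnatr_eq0 -lt0n (bnum_gt0 hG) //;
  lia.
have u1 : u *m const_mx 1 = 0 :> 'M_(1, 1).
  apply: (scalerI b1_neq0); rewrite scalemxAr -N1 mulmxA uN mul0mx.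
  by rewrite scaler0.
have uJ : u *m const_mx 1 = 0 :> 'M_(1, #|S1|).
  rewrite const_mx1_mul.
  by rewrite mulmxA u1 mul0mx.
have := congr1 (mulmx u) NNT; rewrite mulmxA uN mul0mx mulmxDr -scalemxAr uJ.
rewrite scaler0 addr0 mul_mx_scalar => /esym/eqP.
by rewrite scaler_eq0 (negPf b2_neq0) => /eqP.
Qed.

(** The eigenvectors are the images under [N] of the [k - 1] dimensions of
    zero-sum vectors on the neighbours of [x], on which the second term of
    [incidence_local] vanishes. *)
Lemma local_multiplicity :
  (k.-1 <= \rank (eigenspace B ((b 3)%:R - 1)%R :&:
                  kermx (const_mx 1%R : 'rV[R]_#|S2|)^T)%MS)%N.
Proof.
pose K := kermx (const_mx 1 : 'M[R]_(#|S1|, 1)).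
have rkK : (k.-1 <= \rank K)%N.
  rewrite mxrank_ker (card_nbr hG x) -subn1 leq_sub2l //.
  exact: leq_trans (rank_leq_col _) _.
apply: leq_trans rkK _; rewrite -(mxrankMfree K row_free_N); apply: mxrankS.
have K1 : K *m const_mx 1 = 0 :> 'M_(_, 1) by exact: mulmx_ker.
rewrite sub_capmx; apply/andP; split.
  apply/eigenspaceP; rewrite -mulmxA incidence_local mulmxDr -!scalemxAr.
  rewrite const_mx1_mul.
  by rewrite mulmxA K1 mul0mx scaler0 addr0.
apply/sub_kermxP; rewrite trmx_const -mulmxA N1 -scalemxAr K1.
by rewrite scaler0.
Qed.

(** The form of the idempotent of [t] on [w] is a positive multiple of [q_0
    - q_4 + (q_2 - q_4) * eta], because [w] has zero sum and [B] is the
    distance-two relation. By the recurrence, [q_0 - q_2] and [q_2 - q_4]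
    are positive multiples of [(k^2 - t^2) q_0] and [(k^2 - t^2) (t^2 - b_2)
    q_0]. *)
Lemma local_eigenvalue_bound t eta (w : 'rV[R]_#|S2|) :
    eigenvalue A t -> t ^+ 2 < k%:R ^+ 2 ->
    w != 0 -> w *m B = eta *: w -> w *m (const_mx 1 : 'rV_#|S2|)^T = 0 ->
  0 <= (b 2)%:R * (b 3)%:R + (1 + eta) * (t ^+ 2 - (b 2)%:R).
Proof.
move=> /(primitive_idempotent hG) [q [q0 qq qt]] tk w0 wB w1.
have E0 := qt 0%N isT; rewrite /nbr_op (sum_p1_0 hG) in E0.
have rec h : (0 < h < D)%N -> (c h)%:R * q h.-1 + (b h)%:R * q h.+1 = t * q h.
  by move=> hh; rewrite -qt /nbr_op ?(sum_p1 hG) //; lia.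
have E1 := rec 1%N (ltac:(lia)); rewrite (cnum1 hG) mul1r /= in E1.
have E2 := rec 2 (ltac:(lia)); have E3 := rec 3 (ltac:(lia)).
rewrite /= in E2 E3.
have sum_w : \sum_i w 0 i = 0.
  have := congr1 (fun M : 'M_(1, 1) => M 0 0) w1; rewrite !mxE => E.
  by rewrite -[RHS]E; apply: eq_bigr => i _; rewrite !mxE mulr1.
have sum_wB j : \sum_i w 0 i * B i j = eta * w 0 j.
  by have := congr1 (fun M : 'rV_ _ => M 0 j) wB; rewrite !mxE.
pose nw := \sum_i w 0 i ^+ 2.
have nw0 : 0 < nw.
  rewrite lt_neqAle sumr_ge0 ?andbT => [|i _]; last exact: sqr_ge0.
  rewrite eq_sym psumr_eq0 => [|i _]; last exact: sqr_ge0.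
  apply: contra w0 => /allP h; apply/eqP/rowP => i; apply/eqP.
  by have := h i (mem_index_enum i); rewrite sqrf_eq0 mxE.
have psd := idempotent_psd hG (fun i : 'I_#|S2| => enum_val i) (w 0) qq.
have psd' : 0 <= nw * (q 0%N - q 4 + (q 2 - q 4) * eta).
  apply: le_trans psd _; rewrite le_eqVlt; apply/orP; left; apply/eqP.
  rewrite exchange_big /=.
  have inner j : \sum_i w 0 i * w 0 j * q (dist (enum_val i) (enum_val j)) =
      w 0 j ^+ 2 * (q 0%N - q 4 + (q 2 - q 4) * eta).
    (* By parity, vertices at distance two from [x] are at distance 0, 2 or 4
       from each other. *)
    have q_split i : q (dist (enum_val i) (enum_val j)) =
        q 4 + (i == j)%:R * (q 0%N - q 4) + (q 2 - q 4) * B i j.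
      rewrite local_adjmxE -(inj_eq enum_val_inj) -(dist_eq0 hgraph).
      have := odd_dist hgraph x (enum_val i) (enum_val j) hbip.
      have := dist_triangle hgraph x (enum_val i) (enum_val j).
      rewrite (dist_sym hgraph _ x) !distS2 /=.
      by case: (dist _ _) => [|[|[|[|[|n]]]]] //= _ _; ring.
    rewrite (eq_bigr (fun i => w 0 j * q 4 * w 0 i
       + w 0 j * (q 0%N - q 4) * (w 0 i * (i == j)%:R)
       + w 0 j * (q 2 - q 4) * (w 0 i * B i j))) => [|i _]; last first.
      by rewrite q_split; ring.
    rewrite !big_split /= -!mulr_sumr sum_w sum_wB.
    rewrite (bigD1 j) //= eqxx big1 => [|i /negPf ->]; last by rewrite mulr0.
    by rewrite /=; ring.
  by rewrite (eq_bigr _ (fun j _ => inner j)) -mulr_suml.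
rewrite (pmulr_rge0 _ nw0) in psd'.
have k0 : 0 < k%:R :> R by rewrite ltr0n; lia.
have b10 : 0 < (b 1)%:R :> R by rewrite ltr0n (bnum_gt0 hG) //; lia.
have b20 : 0 < (b 2)%:R :> R by rewrite ltr0n (bnum_gt0 hG) //; lia.
have b30 : 0 < (b 3)%:R :> R by rewrite ltr0n (bnum_gt0 hG) //; lia.
have kt : 0 < (k%:R ^+ 2 - t ^+ 2) * q 0%N by rewrite mulr_gt0 ?subr_gt0.
rewrite -(pmulr_rge0 _ kt).
suff -> : (k%:R ^+ 2 - t ^+ 2) * q 0%N *
    ((b 2)%:R * (b 3)%:R + (1 + eta) * (t ^+ 2 - (b 2)%:R)) =
    k%:R * (b 1)%:R * (b 2)%:R * (b 3)%:R * (q 0%N - q 4 + (q 2 - q 4) * eta).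
  by rewrite mulr_ge0 // ltW // !mulr_gt0.
have H2 : k%:R * (b 1)%:R * q 2 = (t ^+ 2 - k%:R) * q 0%N.
  have -> : k%:R * (b 1)%:R * q 2 = k%:R * ((b 1)%:R * q 2) by ring.
  have -> : (b 1)%:R * q 2 = t * q 1%N - q 0%N by rewrite -E1; ring.
  by rewrite mulrBr mulrCA E0; ring.
have H4 : (b 2)%:R * (b 3)%:R * (q 2 - q 4) =
    ((b 2)%:R * k%:R - t ^+ 2) * q 2 + t * (c 2)%:R * q 1%N.
  have b3q : (b 3)%:R * q 4 = t * q 3 - (c 3)%:R * q 2 by rewrite -E3; ring.
  have b2q : (b 2)%:R * q 3 = t * q 2 - (c 2)%:R * q 1%N by rewrite -E2; ring.
  rewrite mulrBr -[_ * _ * q 4]mulrA b3q mulrBr mulrCA b2q.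
  by rewrite (_ : (b 3)%:R = k%:R - (c 3)%:R); [ring|].
have H4' : k%:R * (b 1)%:R * ((b 2)%:R * (b 3)%:R * (q 2 - q 4)) =
    (k%:R ^+ 2 - t ^+ 2) * (t ^+ 2 - (b 2)%:R) * q 0%N.
  rewrite H4 mulrDr mulrCA H2.
  have -> : k%:R * (b 1)%:R * (t * (c 2)%:R * q 1%N) =
      (b 1)%:R * t * (c 2)%:R * (k%:R * q 1%N) by ring.
  rewrite E0 b1E (_ : (c 2)%:R = k%:R - (b 2)%:R); first by ring.
  by rewrite b2E; ring.
have -> : q 0%N - q 4 + (q 2 - q 4) * eta =
  q 0%N - q 2 + (1 + eta) * (q 2 - q 4).
  by ring.
transitivity ((b 2)%:R * (b 3)%:R * (k%:R * (b 1)%:R * q 0%N - k%:R * (b 1)%:R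
  * q 2)
   + (1 + eta) * (k%:R * (b 1)%:R * ((b 2)%:R * (b 3)%:R * (q 2 - q 4))));
     last by ring.
by rewrite H2 H4' b1E; ring.
Qed.

End LocalGraph.

(** * Local eigenvalues and tautness *)

Section SpectralTautness.
Variables (R : rcfType) (X : finType) (e : rel X).
Variable p : nat -> nat -> nat -> nat.
Hypothesis hG : bipartite_drg e p.
Let hgraph : simple_connected_graph e := drg_graph hG.
Let hD : (4 <= diameter e)%N := drg_diameter hG.
Let hk : (3 <= valency p)%N := drg_valency hG.

Local Notation D := (diameter e).
Local Notation d := D./2.
Local Notation k := (valency p).
Local Notation c := (cnum p).
Local Notation b := (bnum p).
Local Notation A := (adjmx R [set: X] e).
Local Notation tilde1 := (theta_tilde p (theta R e 1)).
Local Notation tilded := (theta_tilde p (theta R e d)).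

(** If [b_2 = 1] then [c_2 = c_3 = k - 1], and the identity for [p^2_22]
    makes [k - 1] divide [1]. *)
Lemma bnum2_gt1 : (1 < b 2)%N.
Proof.
rewrite ltn_neqAle (bnum_gt0 hG) ?andbT; last by lia.
apply/negP => /eqP b2.
have h2 := @cb_valency _ _ _ hG 2 (ltac:(lia)).
have h3 := @cb_valency _ _ _ hG 3 (ltac:(lia)).
have b3 := @bnum_gt0 _ _ _ hG 3 (ltac:(lia)).
have c23 := cnum2_le3 hG; have b1 := bnum1 hG.
have c3 : c 3 = c 2 by lia.
have kE : k = (c 2).+1 by lia.
have b1E : b 1 = c 2 by lia.
have := natr_p222 R hG.
rewrite -!natrM -!natrD => /eqP; rewrite eqr_nat => /eqP.
rewrite -b2 c3 b1E kE muln1; move: hk; rewrite kE; move: (c 2) (p 2 2 2) => m P.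
have [mP|Pm] := leqP m P.
  by have := leq_mul (leqnn m) mP; lia.
by have := leq_mul (leqnn m) Pm; rewrite mulnS; lia.
Qed.

(** The list [s] consists of the local eigenvalues [eta_(k+1), ...,
    eta_(k_2)], on which the choice of [eta] has no influence because the
    characteristic polynomial determines the whole multiset. *)
Lemma local_spectrum x : exists s : seq R,
  [/\ spectrally_taut R e p x <-> {in s, forall a, a = tilde1 \/ a = tilded},
      {in s, forall a, tilde1 <= a <= tilded},
      (size s + k)%N = knum p 2,
      \sum_(a <- s) a = - (p 2 2 2)%:R - (k%:R - 1) * ((b 3)%:R - 1)
    & \sum_(a <- s) a ^+ 2 = (knum p 2)%:R * (p 2 2 2)%:R - (p 2 2 2)%:R ^+ 2
                              - (k%:R - 1) * ((b 3)%:R - 1) ^+ 2].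
Proof.
set B := local_adjmx R e x; set P : R := (p 2 2 2)%:R;
  set f : R := (b 3)%:R - 1.
have S2_gt0 : (0 < #|[set y | dist e x y == 2%N]|)%N.
  rewrite (card_S2 hG) lt0n; have := natr_knum2 R hG.
  apply: contra_eq_neq => ->; rewrite mulr0 eq_sym -natrM pnatr_eq0 muln_eq0.
  by rewrite negb_or -!lt0n (bnum_gt0 hG) ?andbT; lia.
have one_neq0 : const_mx 1 != 0 :> 'rV[R]_#|[set y | dist e x y == 2%N]|.
  by apply/eqP => /rowP /(_ (Ordinal S2_gt0)) /eqP; rewrite !mxE oner_eq0.
have [t [tchar tcount tsum tsqr]] :=
  sym_spectrum (local_adjmx_sym R hG x) one_neq0 (local_const_eigenvector R hG
    x).
have size_t : (size t).+1 = knum p 2.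
  have := congr1 (fun g : {poly R} => size g) tchar.
  by rewrite /= size_char_poly size_prod_XsubC /= (card_S2 hG) => -[].
have cnt : (k.-1 <= count_mem f t)%N by rewrite tcount (local_multiplicity R
  hG).
have [s perm_t] : exists s, perm_eq t (nseq k.-1 f ++ s).
  exists (nseq (count_mem f t - k.-1) f ++ filter (predC1 f) t).
  rewrite catA -nseqD subnKC //.
  have /all_pred1P := filter_all (pred1 f) t; rewrite size_filter => <-.
  by rewrite perm_sym perm_filterC.
have kR : (k.-1%:R : R) = k%:R - 1 by rewrite -subn1 natrB //; lia.
have size_s : (size s + k)%N = knum p 2.
  rewrite -size_t (perm_size perm_t) size_cat size_nseq -addSn (ltn_predK hk).
  exact: addnC.
exists s; split => //.
- split=> [[eta [eta_char eta1 eta2] eta_taut] a|taut_s].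
    have split_iota : index_iota 1 (knum p 2).+1 =
      1%N :: iota 2 k.-1 ++ iota k.+1 (size s).
      rewrite /index_iota subSS subn0 -size_s addnC -{1}(prednK (ltac:(lia) :
        (0 < k)%N)).
      by rewrite addSn /= iotaD add2n prednK //; lia.
    have : perm_eq (map eta (index_iota 1 (knum p 2).+1)) (P :: t).
      by apply: prod_XsubC_eq; rewrite -tchar eta_char big_map.
    rewrite split_iota /= map_cat eta1 perm_cons.
    have -> : map eta (iota 2 k.-1) = nseq k.-1 f.
      have /all_pred1P : all (pred1 f) (map eta (iota 2 k.-1)).
        apply/allP => _ /mapP [i hi ->]; rewrite mem_iota in hi.
        by apply/eqP; apply: eta2; lia.
      by rewrite size_map size_iota.
    move/perm_trans/(_ perm_t); rewrite perm_cat2l => /perm_mem <- /mapP [j].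
    by rewrite mem_iota => hi ->; apply: eta_taut; lia.
  pose l := P :: nseq k.-1 f ++ s.
  exists (fun i => nth 0 l i.-1); first split=> //.
  + rewrite -/B tchar (perm_big (P :: nseq k.-1 f ++ s)) ?perm_cons //=.
    rewrite big_add1 /= (big_nth 0) big_mkord big_mkord /= size_cat size_nseq.
    have -> // : (k.-1 + size s).+1 = knum p 2.
    by rewrite -size_s -addSn (ltn_predK hk) addnC.
  + move=> [|[|i]] //= hi; have ik : (i < k.-1)%N by lia.
    by rewrite nth_cat size_nseq nth_nseq ik.
  move=> [|[|i]] //= hi; first by lia.
  rewrite nth_cat size_nseq ifN; last by lia.
  by apply: taut_s; apply: mem_nth; rewrite -(ltn_add2r k) size_s; lia.
- move=> a sa; have ta : a \in t by rewrite (perm_mem perm_t) mem_cat sa orbT.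
  have : (0 < \rank (eigenspace B a :&: kermx (const_mx 1%R :
    'rV[R]__)^T)%MS)%N.
    by rewrite -tcount -has_count has_pred1.
  rewrite lt0n mxrank_eq0 => /rowV0Pn [w];
    rewrite sub_capmx => /andP [/eigenspaceP wB /sub_kermxP w1] w0.
  have /andP [t1 t1k] := theta1_bounds R hG; have td := thetad_bound R hG.
  have tdk : theta R e d ^+ 2 < k%:R ^+ 2 by apply: lt_trans td (lt_trans t1
    t1k).
  have bd i : (i <= D)%N -> theta R e i ^+ 2 < k%:R ^+ 2 ->
      0 <= (b 2)%:R * (b 3)%:R + (1 + a) * (theta R e i ^+ 2 - (b 2)%:R).
    by move=> iD ik; apply: (local_eigenvalue_bound hG (theta_eigenvalue R hG
      iD) ik w0 wB w1).
  have := bd 1%N (ltac:(lia)) t1k; have := bd d (ltac:(lia)) tdk.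
  have gapE y : y ^+ 2 != (b 2)%:R -> (a - theta_tilde p y) * (y ^+ 2 - (b
    2)%:R) =
      (b 2)%:R * (b 3)%:R + (1 + a) * (y ^+ 2 - (b 2)%:R).
    by move=> y0; rewrite /theta_tilde; field; rewrite subr_eq0.
  rewrite -gapE ?lt_eqF // => hd; rewrite -gapE ?gt_eqF // => h1.
  apply/andP; split.
    by rewrite -subr_ge0 -(pmulr_lge0 _ (_ : 0 < theta R e 1 ^+ 2 - (b 2)%:R))
      ?subr_gt0.
  by rewrite -subr_le0 -(nmulr_lge0 _ (_ : theta R e d ^+ 2 - (b 2)%:R < 0))
    ?subr_lt0.
- rewrite big_cons (perm_big _ perm_t) big_cat /= (local_trace R hG) in tsum.
  rewrite big_nseq iter_addr_0 -[f *+ _]mulr_natl kR in tsum.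
  by rewrite -[LHS](addKr (P + (k%:R - 1) * f)) -addrA tsum; ring.
rewrite big_cons (perm_big _ perm_t) big_cat /= (local_trace_sqr R hG) in tsqr.
rewrite big_nseq iter_addr_0 -[f ^+ 2 *+ _]mulr_natl kR in tsqr.
by rewrite -[LHS](addKr (P ^+ 2 + (k%:R - 1) * f ^+ 2)) -addrA tsqr; ring.
Qed.

End SpectralTautness.

(** Here [u = theta_1^2 - b_2] and [w = b_2 - theta_d^2]; [k2], [P], [t1],
    [td] are [k_2], [p^2_22] and the two tilde values; [s1] and [s2] are the
    sums of the remaining local eigenvalues and of their squares. The last
    factor on the left is the sum of the products of [eta - t1] and
    [eta - td], the one on the right the difference of the two sides of the
    tautness equation. *)
Lemma taut_defect_identity (F : fieldType) (k c2 c3 u w : F)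
    (b2 := k - c2) (b3 := k - c3) (k2 := k * (k - 1) / c2)
    (P := ((k - 1) * c2 + c3 * b2 - k) / c2)
    (t1 := - 1 - b2 * b3 / u) (td := - 1 + b2 * b3 / w)
    (s1 := - P - (k - 1) * (b3 - 1))
    (s2 := k2 * P - P ^+ 2 - (k - 1) * (b3 - 1) ^+ 2) :
    c2 != 0 -> u != 0 -> w != 0 ->
  (b2 - 1) * c2 * u * w * (s2 - (t1 + td) * s1 + t1 * td * (k2 - k)) =
  b3 * k * ((k - 1) * ((k - 2) * (c3 - 1) - (c2 - 1) * P) * u * w
    - b3 * (b2 * (k - 2) - (c2 - 1) * (u + b2))
         * (b2 * (k - 2) - (c2 - 1) * (b2 - w))).
Proof.
move=> c20 u0 w0; rewrite /s2 /s1 /t1 /td /P /k2 /b3 /b2; field.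
by rewrite c20 u0 w0.
Qed.

Section Equivalence.
Variables (R : rcfType) (X : finType) (e : rel X).
Variable p : nat -> nat -> nat -> nat.
Hypothesis hG : bipartite_drg e p.

Local Notation tilde1 := (theta_tilde p (theta R e 1)).
Local Notation tilded := (theta_tilde p (theta R e (diameter e)./2)).

(** The terms of [defect] are nonnegative, so it vanishes exactly when every
    remaining local eigenvalue is a tilde value; by [taut_defect_identity]
    its vanishing is the tautness equation. *)
Lemma spectrally_tautP x :
  Delta p R != 0 -> (spectrally_taut R e p x <-> taut R e p).
Proof.
move=> Delta_neq0; have hD := drg_diameter hG; have hk := drg_valency hG.
have [s [sE s_bounds size_s sum_s sum_sqr_s]] := local_spectrum R hG x.
rewrite sE.
pose defect := \sum_(a <- s) (a - tilde1) * (tilded - a).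
have term_ge0 a : a \in s -> 0 <= (a - tilde1) * (tilded - a).
  by move=> /s_bounds /andP [lo hi]; rewrite mulr_ge0 ?subr_ge0.
have defect_eq0 : defect = 0 <-> {in s, forall a, a = tilde1 \/ a = tilded}.
  split=> [d0 a sa|h].
    move/eqP: d0; rewrite /defect big_seq_cond psumr_eq0 =>
      [/allP h|i /andP [/term_ge0]//].
    have := h a sa; rewrite sa /= mulf_eq0 !subr_eq0 => /orP [] /eqP;
      first by left.
    by right.
  rewrite /defect big_seq big1 // => a /h [] ->; first by rewrite subrr mul0r.
  by rewrite subrr mulr0.
have defectE : defect = - (\sum_(a <- s) a ^+ 2 - (tilde1 + tilded) * \sum_(a
  <- s) a
    + tilde1 * tilded * (size s)%:R).
  rewrite /defect; elim: (s) => [|a l IH]; first by rewrite !big_nil /=; ring.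
  by rewrite !big_cons IH /= -[(size l).+1]add1n natrD; ring.
rewrite -defect_eq0 defectE.
have k2E : (bnum p 2)%:R = (valency p)%:R - (cnum p 2)%:R :> R.
  by rewrite (@natr_valency R _ _ _ hG 2); [ring|lia].
have k3E : (bnum p 3)%:R = (valency p)%:R - (cnum p 3)%:R :> R.
  by rewrite (@natr_valency R _ _ _ hG 3); [ring|lia].
have k1E : (bnum p 1)%:R = (valency p)%:R - 1 :> R.
  by rewrite (natr_valency1 R hG); ring.
have c20 : (cnum p 2)%:R != 0 :> R by rewrite gt_eqF // (natr_cnum_gt0 R hG);
  lia.
have knum2E : (knum p 2)%:R = (valency p)%:R * ((valency p)%:R - 1) / (cnum p
  2)%:R :> R.
  by rewrite -k1E -(natr_knum2 R hG) mulrAC mulfV ?mul1r.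
have p222E : (p 2 2 2)%:R = (((valency p)%:R - 1) * (cnum p 2)%:R +
    (cnum p 3)%:R * ((valency p)%:R - (cnum p 2)%:R) - (valency p)%:R) / (cnum
      p 2)%:R :> R.
  by rewrite -k1E -k2E -(natr_p222 R hG) addrK mulrAC mulfV ?mul1r.
have /andP [t1 _] := theta1_bounds R hG; have td := thetad_bound R hG.
set th1 := theta R e 1 in t1 *; set thd := theta R e _ in td *.
pose u := th1 ^+ 2 - (bnum p 2)%:R; pose w := (bnum p 2)%:R - thd ^+ 2.
have u0 : 0 < u by rewrite subr_gt0.
have w0 : 0 < w by rewrite subr_gt0.
have := taut_defect_identity (valency p)%:R (cnum p 3)%:R c20 (lt0r_neq0 u0)
  (lt0r_neq0 w0).
have b2_gt1 : 1 < (bnum p 2)%:R :> R by rewrite ltr1n (bnum2_gt1 R hG).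
have b3_gt0 : 0 < (bnum p 3)%:R :> R by rewrite ltr0n (bnum_gt0 hG) //; lia.
have k_gt0 : 0 < (valency p)%:R :> R by rewrite ltr0n; lia.
have size_sR : (size s)%:R = (knum p 2)%:R - (valency p)%:R :> R.
  by rewrite -size_s natrD addrK.
rewrite -p222E -knum2E -k2E -k3E -k1E -size_sR => identity.
have tE1 : theta_tilde p th1 = - 1 - (bnum p 2)%:R * (bnum p 3)%:R / u by [].
have tEd : theta_tilde p thd = - 1 + (bnum p 2)%:R * (bnum p 3)%:R / w.
  by rewrite /theta_tilde -[_ - (bnum p 2)%:R]opprB invrN mulrN opprK.
rewrite tE1 tEd sum_s sum_sqr_s -k1E.
set S := _ - _ + _ in identity *.
have c_neq0 : ((bnum p 2)%:R - 1) * (cnum p 2)%:R * u * w != 0.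
  have b21 : (bnum p 2)%:R - 1 != 0 :> R by rewrite subr_eq0 gt_eqF.
  by rewrite !mulf_eq0 !negb_or b21 c20 !lt0r_neq0.
have bk_neq0 : (bnum p 3)%:R * (valency p)%:R != 0 :> R.
  by rewrite mulf_eq0 negb_or !lt0r_neq0.
have -> : - S = 0 <-> S = 0 by split=> [/eqP|->];
  rewrite ?oppr0 // oppr_eq0 => /eqP.
have -> : S = 0 <-> ((bnum p 2)%:R - 1) * (cnum p 2)%:R * u * w * S = 0.
  split=> [->|/eqP]; first by rewrite mulr0.
  by rewrite mulf_eq0 (negPf c_neq0) => /eqP.
rewrite {}identity; have -> : u + (bnum p 2)%:R = th1 ^+ 2 by rewrite subrK.
have -> : (bnum p 2)%:R - w = thd ^+ 2 by rewrite opprB addrC subrK.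
rewrite /taut; split=> [/eqP|[_ eq_taut]].
  rewrite mulf_eq0 (negPf bk_neq0) subr_eq0 => /eqP eq_taut.
  by split=> //; rewrite -[LHS]eq_taut.
apply/eqP; rewrite mulf_eq0 (negPf bk_neq0) subr_eq0 eq_sym.
exact/eqP.
Qed.

End Equivalence.

Theorem theorem15p2 (R : rcfType) (X : finType) (e : rel X)
    (p : nat -> nat -> nat -> nat)
    (hgraph : simple_connected_graph e)
    (hbip : bipartite e)
    (hdrg : distance_regular e p)
    (hD : (4 <= diameter e)%N)
    (hk : (3 <= valency p)%N) :
  [<-> taut R e p;
       Delta p R != 0 /\ (forall x : X, spectrally_taut R e p x);
       Delta p R != 0 /\ (exists x : X, spectrally_taut R e p x)].
Proof.
have hG := BipartiteDrg hgraph hbip hdrg hD hk.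
tfae.
- by move=> ht; have [D0 _] := ht; split=> // x;
  apply/(spectrally_tautP hG x D0).
- move=> [D0 ht]; split=> //.
  have [x _] := dist_onto hgraph (leq_trans (isT : 0 < 4)%N hD) (leq0n _).
  by exists x.
- by move=> [D0 [x ht]]; apply/(spectrally_tautP hG x D0).
Qed.
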